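(* Let $n\ge 2$ and let $V(\Lambda)$ be the finite-dimensional irreducible $U_q(n)$-module with highest weight $\Lambda=(\Lambda_1\ge\dots\ge\Lambda_n)\in\mathbb{Z}^n$. Acting on $V(\Lambda)$, the $n\times n$ matrix $\tilde A=(\tilde A_{ij})$ with entries $$\tilde A_{ij}=(q-q^{-1})^{-1}\Big\{\delta_{ij}-\sum_{k\le \min(i,j)}S^{-1}(\hat E_{ki})\,S(\hat E_{jk})\Big\}$$ satisfies the polynomial identity $$\prod_{r=1}^n(\tilde A-\tilde a_r)=0,\qquad \tilde a_r=\frac{1-q^{-2\overline\alpha_r}}{q-q^{-1}},\qquad \overline\alpha_r=\Lambda_r+1-r .$$
   Context: Fix real $q>0$, $q\ne1$. $U_q(n)=U_q[gl(n,\mathbb{C})]$ is the algebra generated by $e_i,f_i$ ($1\le i\le n-1$) and commuting invertible $q^{\pm E_{ii}/2}$ ($1\le i\le n$), with $h_i=E_{ii}-E_{i+1\,i+1}$ and relations $q^{E_{ii}/2}e_jq^{-E_{ii}/2}=q^{(\delta_{ij}-\delta_{i,j+1})/2}e_j$, $q^{E_{ii}/2}f_jq^{-E_{ii}/2}=q^{-(\delta_{ij}-\delta_{i,j+1})/2}f_j$, $[e_i,f_j]=\delta_{ij}\frac{q^{h_i}-q^{-h_i}}{q-q^{-1}}$, and the $q$-Serre relations $x_i^2x_j-(q+q^{-1})x_ix_jx_i+x_jx_i^2=0$ for $|i-j|=1$, $x_ix_j=x_jx_i$ for $|i-j|>1$ ($x=e$ or $x=f$). The coproduct is $\Delta(x)=q^{h_i/2}\otimes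 x+x\otimes q^{-h_i/2}$ for $x=e_i,f_i$, with $q^{E_{ii}/2}$ group-like. The antipode $S$ is the algebra anti-automorphism with $S(e_i)=-q^{-1}e_i$, $S(f_i)=-qf_i$, $S(q^{E_{ii}/2})=q^{-E_{ii}/2}$. Set $E_{i\,i+1}=e_i$, $E_{i+1\,i}=f_i$ and recursively $E_{ij}=E_{ik}E_{kj}-q^{-1}E_{kj}E_{ik}$ for $i<k<j$ or $i>k>j$. Put $\hat E_{ii}=q^{E_{ii}}$ and $\hat E_{ij}=(q-q^{-1})q^{\frac12(E_{ii}+E_{jj}-1)}E_{ij}$ for $i\ne j$. On $V(\Lambda)$ the $E_{ii}$ act diagonalisably with integer eigenvalues, $\Lambda$ being the highest weight. Powers and products of $\tilde A$ are ordinary matrix products with operator entries: $(\tilde A^{m+1})_{ij}=\sum_k\tilde A_{ik}(\tilde A^m)_{kj}$, entries acting on $V(\Lambda)$. *)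

(* Defs.v *)
From HB Require Import structures.
From mathcomp Require Import all_boot all_order all_algebra.
From mathcomp Require Import generic_quotient.
From mathcomp Require Import boolp reals complex.

Set Implicit Arguments.
Unset Strict Implicit.
Unset Printing Implicit Defensive.

Import GRing.Theory.
Local Open Scope ring_scope.
Local Open Scope quotient_scope.

(* U_q[gl(n)] over a field F, for q = s ^ 2.  The square root s = q^(1/2) is  *)
(* a parameter: for q > 0 real it is the positive square root.  All indices   *)
(* are shifted down by one: E_ii and q^(E_ii/2) are indexed by 'I_n, e_i and  *)
(* f_i by 'I_n.-1.                                                            *)

Lemma simple_lo_subproof n (i : 'I_n.-1) : (i < n)%N.
Proof. by rewrite (leq_trans (ltn_ord i)) ?leq_pred. Qed.

Lemma simple_hi_subproof n (i : 'I_n.-1) : (i.+1 < n)%N.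
Proof. by rewrite -ltn_predRL. Qed.

Definition simple_lo n (i : 'I_n.-1) : 'I_n := Ordinal (simple_lo_subproof i).
Definition simple_hi n (i : 'I_n.-1) : 'I_n := Ordinal (simple_hi_subproof i).

(* GenK i stands for q^(E_ii/2) and GenKV i for q^(-E_ii/2).                  *)
Inductive uq_gen (n : nat) :=
  | GenE of 'I_n.-1
  | GenF of 'I_n.-1
  | GenK of 'I_n
  | GenKV of 'I_n.

Inductive uq_term (F : Type) (n : nat) :=
  | Cst of F
  | Gen of uq_gen n
  | Add of uq_term F n & uq_term F n
  | Mul of uq_term F n & uq_term F n.

Arguments Cst {F n}.
Arguments Gen {F n}.

HB.instance Definition _ (F : Type) n := gen_eqMixin (uq_term F n).
HB.instance Definition _ (F : Type) n := gen_choiceMixin (uq_term F n).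

Declare Scope uq_term_scope.
Delimit Scope uq_term_scope with U.
Bind Scope uq_term_scope with uq_term.
Local Infix "+" := Add : uq_term_scope.
Local Infix "*" := Mul : uq_term_scope.
Local Notation "c %:U" := (Cst c) (at level 2, format "c %:U").

Section Presentation.

Variables (F : fieldType) (s : F) (n : nat).

Local Notation q := (s ^+ 2).
Local Notation term := (uq_term F n).
Local Notation e i := (@Gen F n (GenE i)).
Local Notation f i := (@Gen F n (GenF i)).
Local Notation k i := (@Gen F n (GenK i)).
Local Notation kV i := (@Gen F n (GenKV i)).

Definition neg1 : term := (-1)%:U.

(* The exponent of s in q^(E_ii/2) e_j q^(-E_ii/2).                           *)
Definition uq_wt (i : 'I_n) (j : 'I_n.-1) : int :=
  (i == simple_lo j)%:Z - (i == simple_hi j)%:Z.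

Definition uq_serre (x y : term) : term :=
  (x * x * y + (- (q + q^-1))%:U * (x * y * x) + y * x * x)%U.

(* q^(h_i) and q^(-h_i)                                                       *)
Definition term_qh (i : 'I_n.-1) : term :=
  (k (simple_lo i) * k (simple_lo i) * kV (simple_hi i) * kV (simple_hi i))%U.
Definition term_qhV (i : 'I_n.-1) : term :=
  (kV (simple_lo i) * kV (simple_lo i) * k (simple_hi i) * k (simple_hi i))%U.

Inductive uq_rel : term -> term -> Prop :=
  | rel_kC i j : uq_rel (k i * k j) (k j * k i)
  | rel_kV i : uq_rel (k i * kV i) 1%:U
  | rel_Vk i : uq_rel (kV i * k i) 1%:U
  | rel_ke i j : uq_rel (k i * e j * kV i) ((s ^ uq_wt i j)%:U * e j)
  | rel_kf i j : uq_rel (k i * f j * kV i) ((s ^ (- uq_wt i j))%:U * f j)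
  | rel_ef i j :
      uq_rel (e i * f j + neg1 * (f j * e i))
             (((i == j)%:R / (q - q^-1))%:U * (term_qh i + neg1 * term_qhV i))
  | rel_serre_e (i j : 'I_n.-1) of (i.+1 == j :> nat) || (j.+1 == i :> nat) :
      uq_rel (uq_serre (e i) (e j)) 0%:U
  | rel_serre_f (i j : 'I_n.-1) of (i.+1 == j :> nat) || (j.+1 == i :> nat) :
      uq_rel (uq_serre (f i) (f j)) 0%:U
  | rel_far_e (i j : 'I_n.-1) of (i.+1 < j)%N || (j.+1 < i)%N :
      uq_rel (e i * e j) (e j * e i)
  | rel_far_f (i j : 'I_n.-1) of (i.+1 < j)%N || (j.+1 < i)%N :
      uq_rel (f i * f j) (f j * f i).

(* The least congruence making the terms modulo ueq a unital F-algebra in     *)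
(* which uq_rel holds.                                                        *)
Inductive ueq : term -> term -> Prop :=
  | ueq_rel t u of uq_rel t u : ueq t u
  | ueq_refl t : ueq t t
  | ueq_sym t u of ueq t u : ueq u t
  | ueq_trans t u v of ueq t u & ueq u v : ueq t v
  | ueq_add t t' u u' of ueq t t' & ueq u u' : ueq (t + u) (t' + u')
  | ueq_mul t t' u u' of ueq t t' & ueq u u' : ueq (t * u) (t' * u')
  | ueq_addA t u v : ueq (t + (u + v)) (t + u + v)
  | ueq_addC t u : ueq (t + u) (u + t)
  | ueq_add0 t : ueq (0%:U + t) t
  | ueq_addN t : ueq (neg1 * t + t) 0%:U
  | ueq_mulA t u v : ueq (t * (u * v)) (t * u * v)
  | ueq_mul1l t : ueq (1%:U * t) t
  | ueq_mul1r t : ueq (t * 1%:U) t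
  | ueq_mulDl t u v : ueq ((t + u) * v) (t * v + u * v)
  | ueq_mulDr t u v : ueq (t * (u + v)) (t * u + t * v)
  | ueq_cstD a b : ueq (a + b)%:U (a%:U + b%:U)
  | ueq_cstM a b : ueq (a * b)%:U (a%:U * b%:U)
  | ueq_cstC a t : ueq (a%:U * t) (t * a%:U).

Definition ueqb (t u : term) : bool := `[< ueq t u >].

Lemma ueqb_equiv : equiv_class_of ueqb.
Proof.
split=> [t|t u|u t v].
- by apply/asboolP/ueq_refl.
- by apply/asboolP/asboolP; apply: ueq_sym.
- by move=> /asboolP tu /asboolP uv; apply/asboolP/(ueq_trans tu uv).
Qed.

Canonical ueqb_equiv_rel := EquivRelPack ueqb_equiv.
Canonical ueqb_encModRel := defaultEncModRel ueqb.

Definition uq : Type := {eq_quot ueqb}.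

HB.instance Definition _ : EqQuotient term ueqb uq := EqQuotient.on uq.
HB.instance Definition _ := Choice.on uq.

Definition uqpi (t : term) : uq := \pi_uq t.

Lemma uqpiP t u : uqpi t = uqpi u <-> ueq t u.
Proof. by split=> [/eqmodP/asboolP|tu]; last exact/eqmodP/asboolP. Qed.

Lemma uqpi_surj x : exists t, x = uqpi t.
Proof. by exists (repr x); rewrite /uqpi reprK. Qed.

Lemma ueq_repr t : ueq (repr (uqpi t)) t.
Proof. by apply/uqpiP; rewrite /uqpi reprK. Qed.

Definition uq_add (x y : uq) := uqpi (repr x + repr y)%U.
Definition uq_mul (x y : uq) := uqpi (repr x * repr y)%U.
Definition uq_cst (a : F) := uqpi a%:U.
Definition uq_opp (x : uq) := uq_mul (uq_cst (-1)) x.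

Lemma uqpiD t u : uqpi (t + u)%U = uq_add (uqpi t) (uqpi u).
Proof. by apply/uqpiP/ueq_add; apply/ueq_sym/ueq_repr. Qed.

Lemma uqpiM t u : uqpi (t * u)%U = uq_mul (uqpi t) (uqpi u).
Proof. by apply/uqpiP/ueq_mul; apply/ueq_sym/ueq_repr. Qed.

Lemma uqpi_cst a : uqpi a%:U = uq_cst a. Proof. by []. Qed.

Let lift := (uqpi_cst, uqpiD, uqpiM).

Fact uq_addA : associative uq_add.
Proof.
move=> x y z; have [t ->] := uqpi_surj x.
have [u ->] := uqpi_surj y; have [v ->] := uqpi_surj z.
by rewrite -!lift; apply/uqpiP/ueq_addA.
Qed.

Fact uq_addC : commutative uq_add.
Proof.
move=> x y; have [t ->] := uqpi_surj x; have [u ->] := uqpi_surj y.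
by rewrite -!lift; apply/uqpiP/ueq_addC.
Qed.

Fact uq_add0 : left_id (uq_cst 0) uq_add.
Proof.
by move=> x; have [t ->] := uqpi_surj x; rewrite -!lift; apply/uqpiP/ueq_add0.
Qed.

Fact uq_addN : left_inverse (uq_cst 0) uq_opp uq_add.
Proof.
move=> x; have [t ->] := uqpi_surj x.
by rewrite /uq_opp -!lift; apply/uqpiP/ueq_addN.
Qed.

HB.instance Definition _ := GRing.isZmodule.Build uq uq_addA uq_addC uq_add0 uq_addN.

Fact uq_mulA : associative uq_mul.
Proof.
move=> x y z; have [t ->] := uqpi_surj x.
have [u ->] := uqpi_surj y; have [v ->] := uqpi_surj z.
by rewrite -!lift; apply/uqpiP/ueq_mulA.
Qed.

Fact uq_mul1l : left_id (uq_cst 1) uq_mul.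
Proof.
by move=> x; have [t ->] := uqpi_surj x; rewrite -!lift; apply/uqpiP/ueq_mul1l.
Qed.

Fact uq_mul1r : right_id (uq_cst 1) uq_mul.
Proof.
by move=> x; have [t ->] := uqpi_surj x; rewrite -!lift; apply/uqpiP/ueq_mul1r.
Qed.

Fact uq_mulDl : left_distributive uq_mul uq_add.
Proof.
move=> x y z; have [t ->] := uqpi_surj x.
have [u ->] := uqpi_surj y; have [v ->] := uqpi_surj z.
by rewrite -!lift; apply/uqpiP/ueq_mulDl.
Qed.

Fact uq_mulDr : right_distributive uq_mul uq_add.
Proof.
move=> x y z; have [t ->] := uqpi_surj x.
have [u ->] := uqpi_surj y; have [v ->] := uqpi_surj z.
by rewrite -!lift; apply/uqpiP/ueq_mulDr.
Qed.

HB.instance Definition _ :=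
  GRing.Zmodule_isPzRing.Build uq uq_mulA uq_mul1l uq_mul1r uq_mulDl uq_mulDr.

Lemma uqpiDE t u : uqpi (t + u)%U = uqpi t + uqpi u.
Proof. exact: uqpiD. Qed.

Lemma uqpiME t u : uqpi (t * u)%U = uqpi t * uqpi u.
Proof. exact: uqpiM. Qed.

Lemma uq_cstD a b : uq_cst (a + b) = uq_cst a + uq_cst b.
Proof. by rewrite /uq_cst -uqpiDE; apply/uqpiP/ueq_cstD. Qed.

Lemma uq_cstM a b : uq_cst (a * b) = uq_cst a * uq_cst b.
Proof. by rewrite /uq_cst -uqpiME; apply/uqpiP/ueq_cstM. Qed.

Lemma uq_cstC a x : uq_cst a * x = x * uq_cst a.
Proof.
by have [t ->] := uqpi_surj x; rewrite /uq_cst -!uqpiME; apply/uqpiP/ueq_cstC.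
Qed.

Fixpoint uq_eval (A : pzRingType) (c : F -> A) (g : uq_gen n -> A) (t : term) : A :=
  match t with
  | Cst a => c a
  | Gen x => g x
  | Add t u => uq_eval c g t + uq_eval c g u
  | Mul t u => uq_eval c g t * uq_eval c g u
  end.

Lemma uq_eval_ueq (A : pzRingType) (c : {rmorphism F -> A}) (g : uq_gen n -> A) :
    (forall a x, c a * x = x * c a) ->
    (forall t u, uq_rel t u -> uq_eval c g t = uq_eval c g u) ->
  forall t u, ueq t u -> uq_eval c g t = uq_eval c g u.
Proof.
move=> cC grel t u; elim=> {t u} //=.
- by move=> t u v _ -> _ ->.
- by move=> t t' u u' _ -> _ ->.
- by move=> t t' u u' _ -> _ ->.
- by move=> *; rewrite addrA.
- by move=> *; rewrite addrC.
- by move=> *; rewrite rmorph0 add0r.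
- by move=> *; rewrite rmorphN rmorph1 rmorph0 mulN1r addNr.
- by move=> *; rewrite mulrA.
- by move=> *; rewrite rmorph1 mul1r.
- by move=> *; rewrite rmorph1 mulr1.
- by move=> *; rewrite mulrDl.
- by move=> *; rewrite mulrDr.
- by move=> *; rewrite rmorphD.
- by move=> *; rewrite rmorphM.
Qed.

Fact uq_1neq0 : (1 : uq) != 0.
Proof.
pose eps (x : uq_gen n) : F := match x with GenK _ | GenKV _ => 1 | _ => 0 end.
apply/eqP => /uqpiP /(@uq_eval_ueq F idfun eps) /= H.
suff /eqP : (1 : F) = 0 by rewrite oner_eq0.
apply: H => [a x|t u]; first exact: mulrC.
by case=> * /=; rewrite ?(mulr0, mul0r, mulr1, add0r, mulN1r, subrr).
Qed.

HB.instance Definition _ := GRing.PzSemiRing_isNonZero.Build uq uq_1neq0.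

Definition uq_scale (a : F) (x : uq) : uq := uq_cst a * x.

Fact uq_scaleA a b x : uq_scale a (uq_scale b x) = uq_scale (a * b) x.
Proof. by rewrite /uq_scale uq_cstM mulrA. Qed.

Fact uq_scale1 : left_id 1 uq_scale. Proof. exact: mul1r. Qed.

Fact uq_scaleDr : right_distributive uq_scale +%R.
Proof. by move=> *; apply: mulrDr. Qed.

Fact uq_scaleDl x : {morph uq_scale^~ x : a b / a + b}.
Proof. by move=> a b; rewrite /uq_scale uq_cstD mulrDl. Qed.

HB.instance Definition _ :=
  GRing.Zmodule_isLmodule.Build F uq uq_scaleA uq_scale1 uq_scaleDr uq_scaleDl.

Fact uq_scaleAl (a : F) (x y : uq) : a *: (x * y) = a *: x * y.
Proof. exact: mulrA. Qed.

HB.instance Definition _ := GRing.Lmodule_isLalgebra.Build F uq uq_scaleAl.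

Fact uq_scaleAr (a : F) (x y : uq) : a *: (x * y) = x * (a *: y).
Proof.
by rewrite -![_ *: _]/(uq_cst _ * _) !mulrA (uq_cstC a x).
Qed.

HB.instance Definition _ := GRing.Lalgebra_isAlgebra.Build F uq uq_scaleAr.

Lemma uq_scaleE :
  (forall c (x y : uq), (c *: x) * y = c *: (x * y)) *
  (forall c (x y : uq), x * (c *: y) = c *: (x * y)).
Proof. by split=> *; [rewrite scalerAl|rewrite scalerAr]. Qed.

Lemma uq_cstE a : uqpi a%:U = a%:A.
Proof. by rewrite -[RHS]/(uq_cst a * 1) mulr1. Qed.

Definition uq_e i : uq := uqpi (e i).
Definition uq_f i : uq := uqpi (f i).
Definition uq_k i : uq := uqpi (k i).
Definition uq_kV i : uq := uqpi (kV i).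

(* For a * b = 1, uq_anti a b is the algebra anti-automorphism sending e_i to *)
(* - a e_i, f_i to - b f_i and q^(E_ii/2) to q^(-E_ii/2): see uq_antiM,       *)
(* uq_anti_linear, uq_anti_gen and uq_antiK.  Hence the antipode S and its    *)
(* inverse antipodeV, which scales e_i by - q and f_i by - q^-1.              *)

Fixpoint anti_term (a b : F) (t : term) : term :=
  match t with
  | Cst c => c%:U
  | Gen (GenE i) => ((- a)%:U * e i)%U
  | Gen (GenF i) => ((- b)%:U * f i)%U
  | Gen (GenK i) => kV i
  | Gen (GenKV i) => k i
  | Add t u => (anti_term a b t + anti_term a b u)%U
  | Mul t u => (anti_term a b u * anti_term a b t)%U
  end.

Definition uq_anti (a b : F) (x : uq) : uq := uqpi (anti_term a b (repr x)).

Definition antipode : uq -> uq := uq_anti q^-1 q.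
Definition antipodeV : uq -> uq := uq_anti q q^-1.

Lemma uqpi_rel t u : uq_rel t u -> uqpi t = uqpi u.
Proof. by move=> tu; apply/uqpiP/ueq_rel. Qed.

Let uqpiE := (uqpiDE, uqpiME, uq_cstE, mulr_algl, mulr_algr).

Lemma uq_kK i : uq_k i * uq_kV i = 1.
Proof. by have := uqpi_rel (rel_kV i); rewrite uqpiME. Qed.

Lemma uq_kVK i : uq_kV i * uq_k i = 1.
Proof. by have := uqpi_rel (rel_Vk i); rewrite uqpiME. Qed.

Lemma uq_kC i j : uq_k i * uq_k j = uq_k j * uq_k i.
Proof. by have := uqpi_rel (rel_kC i j); rewrite !uqpiME. Qed.

Lemma uq_kkVC i j : uq_k i * uq_kV j = uq_kV j * uq_k i.
Proof.
rewrite -[LHS]mul1r -(uq_kVK j) -mulrA (mulrA (uq_k j)) uq_kC.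
by rewrite -mulrA uq_kK mulr1.
Qed.

Lemma uq_kVC i j : uq_kV i * uq_kV j = uq_kV j * uq_kV i.
Proof.
rewrite -[LHS]mul1r -(uq_kVK j) -mulrA (mulrA (uq_k j)) uq_kkVC.
by rewrite -mulrA uq_kK mulr1.
Qed.

Lemma uqpi_serre t u (x := uqpi t) (y := uqpi u) :
  uqpi (uq_serre t u) = x * x * y - (q + q^-1) *: (x * y * x) + y * x * x.
Proof. by rewrite !uqpiE scaleNr. Qed.

Section Anti.

Variables (a b : F).
Hypothesis ab1 : a * b = 1.

Local Notation S t := (uqpi (anti_term a b t)).

Lemma anti_serre t u c : S t = c *: uqpi t -> S u = c *: uqpi u ->
  S (uq_serre t u) = (c * c * c) *: uqpi (uq_serre t u).
Proof.
move=> St Su; rewrite uqpi_serre /= !uqpiE St Su scaleNr.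
rewrite -!(scalerAl, scalerAr) !scalerA !scalerDr scalerN !scalerA.
have -> : c * (c * c) = c * c * c by rewrite mulrA.
have -> : (q + q^-1) * c * (c * c) = c * c * c * (q + q^-1).
  by rewrite -mulrA [LHS]mulrC !mulrA.
by rewrite [LHS]addrC addrA addrAC !mulrA.
Qed.

Lemma anti_rel t u : uq_rel t u -> S t = S u.
Proof.
have sqC (x y : uq) : x * y = y * x -> x * x * y * y = y * (y * (x * x)).
  by move=> xy; rewrite -mulrA [RHS]mulrA; apply: commrM; apply/commr_sym/commrM.
case=> {t u}.
- by move=> i j /=; rewrite !uqpiE; apply: uq_kVC.
- by move=> i /=; rewrite !uqpiE scale1r; apply: uq_kK.
- by move=> i /=; rewrite !uqpiE scale1r; apply: uq_kVK.
- move=> i j; have /esym := uqpi_rel (rel_ke i j); rewrite /= !uqpiE => kek.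
  by rewrite !uq_scaleE mulrA -kek !scalerA mulrC.
- move=> i j; have /esym := uqpi_rel (rel_kf i j); rewrite /= !uqpiE => kfk.
  by rewrite !uq_scaleE mulrA -kfk !scalerA mulrC.
- move=> i j; have := uqpi_rel (rel_ef i j); rewrite /= !uqpiE.
  rewrite !uq_scaleE !scalerA !mulrNN (mulrC b a) ab1 mulr1 !scaleN1r scale1r.
  rewrite !sqC ?uq_kkVC // => ef.
  by rewrite -opprB ef -scalerN opprB !mulrA.
- move=> i j ij; rewrite (@anti_serre _ _ (- a)); [|by rewrite /= uqpiE..].
  by rewrite (uqpi_rel (rel_serre_e ij)) /= uqpiE scale0r scaler0.
- move=> i j ij; rewrite (@anti_serre _ _ (- b)); [|by rewrite /= uqpiE..].
  by rewrite (uqpi_rel (rel_serre_f ij)) /= uqpiE scale0r scaler0.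
- move=> i j ij; have := uqpi_rel (rel_far_e ij).
  by rewrite /= !uqpiE !uq_scaleE => ->.
- move=> i j ij; have := uqpi_rel (rel_far_f ij).
  by rewrite /= !uqpiE !uq_scaleE => ->.
Qed.

Lemma uq_antipi t : uq_anti a b (uqpi t) = S t.
Proof.
have ant u v : ueq u v -> S u = S v.
  elim=> {u v} /=.
  - exact: anti_rel.
  - by [].
  - by [].
  - by move=> u v w _ -> _ ->.
  - by move=> u u' v v' _ Su _ Sv; rewrite !uqpiE Su Sv.
  - by move=> u u' v v' _ Su _ Sv; rewrite !uqpiE Su Sv.
  - by move=> *; rewrite !uqpiE addrA.
  - by move=> *; rewrite !uqpiE addrC.
  - by move=> *; rewrite !uqpiE scale0r add0r.
  - by move=> *; rewrite !uqpiE scaleN1r scale0r addNr.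
  - by move=> *; rewrite !uqpiE mulrA.
  - by move=> *; rewrite !uqpiE scale1r.
  - by move=> *; rewrite !uqpiE scale1r.
  - by move=> *; rewrite !uqpiE mulrDr.
  - by move=> *; rewrite !uqpiE mulrDl.
  - by move=> *; rewrite !uqpiE scalerDl.
  - by move=> *; rewrite !uqpiE scalerA mulrC.
  - by move=> *; rewrite !uqpiE.
exact/ant/ueq_repr.
Qed.

Lemma uq_antiM x y : uq_anti a b (x * y) = uq_anti a b y * uq_anti a b x.
Proof.
have [t ->] := uqpi_surj x; have [u ->] := uqpi_surj y.
by rewrite -uqpiME !uq_antipi /= uqpiME.
Qed.

Lemma uq_anti_linear : linear (uq_anti a b).
Proof.
move=> c x y; have [t ->] := uqpi_surj x; have [u ->] := uqpi_surj y.
by rewrite -mulr_algl -uq_cstE -uqpiME -uqpiDE !uq_antipi /= !uqpiE.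
Qed.

Lemma uq_anti_gen :
  [/\ forall i, uq_anti a b (uq_e i) = - a *: uq_e i,
      forall i, uq_anti a b (uq_f i) = - b *: uq_f i,
      forall i, uq_anti a b (uq_k i) = uq_kV i
    & forall i, uq_anti a b (uq_kV i) = uq_k i].
Proof. by split=> i; rewrite uq_antipi /= ?uqpiE. Qed.

End Anti.

Lemma uq_antiK a b : a * b = 1 -> cancel (uq_anti a b) (uq_anti b a).
Proof.
move=> ab1; have ba1 : b * a = 1 by rewrite mulrC.
move=> x; have [t ->] := uqpi_surj x; rewrite uq_antipi // uq_antipi //.
elim: t => //= [[]|t IHt u IHu|t IHt u IHu] // *; rewrite !uqpiE ?IHt ?IHu //.
  by rewrite scalerA mulrNN ab1 scale1r.
by rewrite scalerA mulrNN ba1 scale1r.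
Qed.

Lemma antipodeK : s != 0 -> cancel antipode antipodeV.
Proof. by move=> s0; apply: uq_antiK; rewrite mulVf // expf_neq0. Qed.

Lemma antipodeVK : s != 0 -> cancel antipodeV antipode.
Proof. by move=> s0; apply: uq_antiK; rewrite mulfV // expf_neq0. Qed.

(* E_(i, i+d+1) and E_(i+d+1, i), the recursion being taken at the largest   *)
(* intermediate index; by uq_E_rec every other choice gives the same element. *)
Definition qcomm (x y : uq) : uq := x * y - q^-1 *: (y * x).

Definition nat_e (m : nat) : uq := if insub m is Some i then uq_e i else 0.
Definition nat_f (m : nat) : uq := if insub m is Some i then uq_f i else 0.

Fixpoint uq_Eup (i d : nat) : uq :=
  if d is d'.+1 then qcomm (uq_Eup i d') (nat_e (i + d)) else nat_e i.

Fixpoint uq_Edown (i d : nat) : uq :=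
  if d is d'.+1 then qcomm (nat_f (i + d)) (uq_Edown i d') else nat_f i.

(* The diagonal value is a dummy: E_ii itself is not an element of uq.        *)
Definition uq_E (i j : 'I_n) : uq :=
  if (i < j)%N then uq_Eup i (j - i.+1)
  else if (j < i)%N then uq_Edown j (i - j.+1) else 0.

Definition uq_Ehat (i j : 'I_n) : uq :=
  if i == j then uq_k i ^+ 2
  else ((q - q^-1) * s^-1) *: (uq_k i * uq_k j * uq_E i j).

Definition uq_A : 'M[uq]_n :=
  \matrix_(i, j) ((q - q^-1)^-1 *:
    ((i == j)%:R - \sum_(m < n | (m <= i)%N && (m <= j)%N)
                      antipodeV (uq_Ehat m i) * antipode (uq_Ehat j m))).

Lemma uq_E_simple (i : 'I_n.-1) :
  uq_E (simple_lo i) (simple_hi i) = uq_e i /\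
  uq_E (simple_hi i) (simple_lo i) = uq_f i.
Proof.
by rewrite /uq_E /= ltnSn ltnNge leqnSn /= subnn /= /nat_e /nat_f valK.
Qed.

Lemma qcommA x y z : x * z = z * x -> qcomm (qcomm x y) z = qcomm x (qcomm y z).
Proof.
move=> xz; rewrite /qcomm !(mulrBl, mulrBr) !uq_scaleE !scalerBr !opprB.
have -> : y * x * z = y * z * x by rewrite -!mulrA xz.
have -> : z * (x * y) = x * (z * y) by rewrite !mulrA xz.
by rewrite !mulrA [LHS]addrACA [RHS]addrACA; congr (_ + _); apply: addrC.
Qed.

Lemma nat_e_far a b : (a.+1 < b)%N -> nat_e a * nat_e b = nat_e b * nat_e a.
Proof.
rewrite /nat_e; case: insubP => [i _ <-|_]; last by rewrite mul0r mulr0.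
case: insubP => [j _ <-|_ _]; last by rewrite mul0r mulr0.
move=> ij; have /rel_far_e/uqpi_rel : (i.+1 < j)%N || (j.+1 < i)%N by rewrite ij.
by rewrite !uqpiE.
Qed.

Lemma nat_f_far a b : (a.+1 < b)%N -> nat_f a * nat_f b = nat_f b * nat_f a.
Proof.
rewrite /nat_f; case: insubP => [i _ <-|_]; last by rewrite mul0r mulr0.
case: insubP => [j _ <-|_ _]; last by rewrite mul0r mulr0.
move=> ij; have /rel_far_f/uqpi_rel : (i.+1 < j)%N || (j.+1 < i)%N by rewrite ij.
by rewrite !uqpiE.
Qed.

Lemma comm_qcomm x y z :
  GRing.comm z x -> GRing.comm z y -> GRing.comm z (qcomm x y).
Proof.
move=> zx zy; apply: commrB; first exact: commrM.
rewrite -mulr_algl; apply: commrM; last exact: commrM.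
by rewrite /GRing.comm mulr_algl mulr_algr.
Qed.

Lemma uq_Eup_far i d m :
  ((i + d).+1 < m)%N -> GRing.comm (nat_e m) (uq_Eup i d).
Proof.
elim: d => [|d IHd] /= lt_m.
  by apply/commr_sym/nat_e_far; rewrite addn0 in lt_m.
by apply: comm_qcomm; [apply: IHd; apply: leq_trans lt_m; rewrite addnS|apply/commr_sym/nat_e_far].
Qed.

Lemma uq_Edown_far i d m :
  ((i + d).+1 < m)%N -> GRing.comm (nat_f m) (uq_Edown i d).
Proof.
elim: d => [|d IHd] /= lt_m.
  by apply/commr_sym/nat_f_far; rewrite addn0 in lt_m.
by apply: comm_qcomm; [apply/commr_sym/nat_f_far|apply: IHd; apply: leq_trans lt_m; rewrite addnS].
Qed.

Lemma uq_Eup_split i a b :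
  uq_Eup i (a + b.+1) = qcomm (uq_Eup i a) (uq_Eup (i + a.+1) b).
Proof.
elim: b => [|b IHb]; first by rewrite addn1.
rewrite addnS /= IHb qcommA ?addnS ?addSn ?addnA //.
by apply/commr_sym/uq_Eup_far; rewrite !ltnS leq_addr.
Qed.

Lemma uq_Edown_split i a b :
  uq_Edown i (a + b.+1) = qcomm (uq_Edown (i + a.+1) b) (uq_Edown i a).
Proof.
elim: b => [|b IHb]; first by rewrite addn1.
rewrite addnS /= IHb -qcommA ?addnS ?addSn ?addnA //.
by apply: uq_Edown_far; rewrite !ltnS leq_addr.
Qed.

Lemma uq_E_rec (i m j : 'I_n) : (i < m < j)%N || (j < m < i)%N ->
  uq_E i j = uq_E i m * uq_E m j - q^-1 *: (uq_E m j * uq_E i m).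
Proof.
rewrite -/(qcomm _ _) /uq_E; case/orP=> /andP[lt1 lt2].
  rewrite lt1 lt2 (ltn_trans lt1 lt2).
  have -> : (j - i.+1 = (m - i.+1) + (j - m.+1).+1)%N.
    by rewrite -subSn // subSS addnC addnBA // subnK // ltnW.
  by rewrite uq_Eup_split -subSn // subSS subnKC // ltnW.
have lt12 := ltn_trans lt1 lt2.
rewrite lt1 lt2 lt12 !ltnNge !(ltnW lt1) !(ltnW lt2) (ltnW lt12) /=.
have -> : (i - j.+1 = (m - j.+1) + (i - m.+1).+1)%N.
  by rewrite -subSn // subSS addnC addnBA // subnK // ltnW.
by rewrite uq_Edown_split -subSn // subSS subnKC // ltnW.
Qed.

End Presentation.

Section Modules.

Variables (F : fieldType) (s : F) (n : nat).

Record uq_module (V : vectType F) := UqModule {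
  uq_act :> uq s n -> V -> V;
  uq_act_linearl : forall v, linear (uq_act^~ v);
  uq_act_linearr : forall x, linear (uq_act x);
  uq_act1 : forall v, uq_act 1 v = v;
  uq_actM : forall x y v, uq_act (x * y) v = uq_act x (uq_act y v)
}.

Definition irreducible_module (V : vectType F) (M : uq_module V) : Prop :=
  (exists v : V, v != 0) /\
  forall W : {vspace V}, (forall x v, v \in W -> M x v \in W) ->
    W = 0%VS \/ W = fullv.

(* q^(E_ii/2) acts on a vector of weight L by q^(L_i/2) = s ^ L i.            *)
Definition has_highest_weight (V : vectType F) (M : uq_module V)
    (L : 'I_n -> int) : Prop :=
  exists v : V, [/\ v != 0, forall i, M (uq_e s i) v = 0
                  & forall i, M (uq_k s i) v = s ^ L i *: v].

End Modules.

(* Main.v *)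
(* Up to the affine change uq_A = (1 - X) / (q - q^-1), the claim is that
   prod_r (X - c_r^-1) = 0 with c_r = q^(2 (L_r - r)), indices starting at 0.
   Let U_ab = Ehat_ab (a <= b) and D_ba = Ehat_ba (a <= b) be the triangular
   L-operators.  By the antipode identities X = S^-1(U)^T S(D)^T is inverse to
   Y = D^T U^T.  Both factors of Y intertwine the coproduct with its opposite
   in the vector representation, so Y is a U_q(n)-endomorphism of C^n (x) V.
   Let v be a highest weight vector and W_j the submodule generated by the
   e_i (x) v with i < j.  Since U^T (e_j (x) v) = q^(L_j) e_j (x) v, and
   D^T (e_j (x) v) = q^(L_j - 2j) e_j (x) v modulo W_j, one gets
   (Y - c_j) W_(j+1) <= W_j; as V is irreducible, W_n is the whole space. *)

From HB Require Import structures.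
Require Import Defs.
From mathcomp Require Import all_boot all_order all_algebra.
From mathcomp Require Import boolp reals complex ring zify.

Set Implicit Arguments.
Unset Strict Implicit.
Unset Printing Implicit Defensive.

Import Order.TTheory GRing.Theory Num.Theory.
Local Open Scope ring_scope.

(** The intertwining property is checked against simple generators only, but for root vectors of
    every height. The relation z K_m D_ba = [D_bm, D_ma] reduces most checks to smaller height, K_m
    being invertible. The obstacle is a simple root strictly inside a longer one: already for three
    simple roots, neither splitting has both pieces q-commuting with the simple vector. Comparing
    the two splittings decides this case, up to a factor q + q^-1; hence the condition q^2 + 1 <> 0.
    All this is done for an abstract triangular family D. The reversal [uq_rev] transfers it to U
    and turns S into S^-1, which explains the S^-1 in X. The q^(-2j) in c_j comes from the
    intertwining property: passing from e_j to e_(j+1) costs q^-1 for moving K_j past F_j and q^-1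
    for the coproduct of F_j. This passage changes the vector of V, so the congruence is proved for
    arbitrary vectors. *)

Section LinearExpressions.

(** * Linear identities, decided coefficient by coefficient *)

Variables (F : pzRingType) (V : lmodType F).

Inductive lin_expr :=
  | LinZero
  | LinVar of nat
  | LinAdd of lin_expr & lin_expr
  | LinOpp of lin_expr
  | LinScale of F & lin_expr.

Fixpoint lin_eval (env : seq V) t : V :=
  match t with
  | LinZero => 0
  | LinVar i => env`_i
  | LinAdd t u => lin_eval env t + lin_eval env u
  | LinOpp t => - lin_eval env t
  | LinScale c t => c *: lin_eval env t
  end.

(* Nat.eqb, unlike ==, is unfolded by cbn in the tactic lin below. *)
Fixpoint lin_coef t (i : nat) : F :=
  match t with
  | LinZero => 0
  | LinVar j => if Nat.eqb i j then 1 else 0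
  | LinAdd t u => lin_coef t i + lin_coef u i
  | LinOpp t => - lin_coef t i
  | LinScale c t => c * lin_coef t i
  end.

(** A recursive conjunction instead of a quantifier over indices: at a concrete length it unfolds
    into one scalar equation per atom. *)
Fixpoint lin_same t u (i : nat) : Prop :=
  if i is i'.+1 then lin_coef t i' = lin_coef u i' /\ lin_same t u i' else True.

Lemma lin_evalE env t :
  lin_eval env t = \sum_(i < size env) lin_coef t i *: env`_i.
Proof.
elim: t => [|i|t IHt u IHu|t IHt|c t IHt] /=.
- by rewrite big1 // => i _; rewrite scale0r.
- rewrite (eq_bigr (fun j : 'I__ => if j == i :> nat then env`_j else 0)).
    case: (ltnP i (size env)) => lt_i.
      by rewrite -big_mkcond (big_pred1 (Ordinal lt_i)).
    (* A variable beyond the environment reads the default 0, so every summand has to vanish. *)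
    rewrite big1 ?nth_default // => j _; case: eqP => // ji.
    by have := ltn_ord j; rewrite ji ltnNge lt_i.
  move=> j _; case: eqP => [->|ne]; first by rewrite PeanoNat.Nat.eqb_refl scale1r.
  by move/PeanoNat.Nat.eqb_neq: ne => ->; rewrite scale0r.
- by rewrite IHt IHu -big_split; apply: eq_bigr => i _; rewrite scalerDl.
- by rewrite IHt -sumrN; apply: eq_bigr => i _; rewrite scaleNr.
- by rewrite IHt scaler_sumr; apply: eq_bigr => i _; rewrite scalerA.
Qed.

Lemma lin_sameP env t u :
  lin_same t u (size env) -> lin_eval env t = lin_eval env u.
Proof.
move=> tu; rewrite !lin_evalE; apply: eq_bigr => i _; congr (_ *: _).
elim: (size env) i tu => [[]//|k IHk] i /= [tuk tu].
case: (ltngtP i k) => [lt_ik|gt_ik|-> //]; first exact: (IHk (Ordinal lt_ik)).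
by have := ltn_ord i; rewrite ltnS leqNgt gt_ik.
Qed.

End LinearExpressions.

(** The [match goal] wrapper lets [unify] run while a term is being computed, so atoms are compared
    up to unification and not syntactically. *)
Ltac lin_index x env :=
  match env with
  | ?y :: _ => let _ := match goal with _ => unify x y end in constr:(0%N)
  | _ :: ?env' => let i := lin_index x env' in constr:(i.+1)
  end.

Ltac lin_atoms t env :=
  lazymatch t with
  | 0 => env
  | ?a + ?b => let env1 := lin_atoms a env in lin_atoms b env1
  | - ?a => lin_atoms a env
  | _ *: ?a => lin_atoms a env
  | _ => match env with
         | _ => let i := lin_index t env in env
         | _ => constr:(t :: env)
         end
  end.

Ltac lin_quote F t env :=
  lazymatch t with
  | 0 => constr:(@LinZero F)
  | ?a + ?b => let a' := lin_quote F a env in let b' := lin_quote F b env in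
               constr:(@LinAdd F a' b')
  | - ?a => let a' := lin_quote F a env in constr:(@LinOpp F a')
  | ?c *: ?a => let a' := lin_quote F a env in constr:(@LinScale F c a')
  | _ => let i := lin_index t env in constr:(@LinVar F i)
  end.

(* lin F reduces a linear identity between module elements to one scalar goal
   per atom, atoms being the maximal subterms that are not linear expressions. *)
Ltac lin F :=
  lazymatch goal with
  | |- @eq ?V ?l ?r =>
    let env := lin_atoms l (@nil V) in let env := lin_atoms r env in
    let l' := lin_quote F l env in let r' := lin_quote F r env in
    refine (@lin_sameP F _ env l' r' _);
    cbn -[GRing.add GRing.mul GRing.opp GRing.one GRing.zero GRing.inv GRing.exp];
    repeat split
  end.

(** * The q-Serre relations as q-commutations *)

Section NCExpand.
Variables (F : fieldType) (A : algType F).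
(** A rewriting system that distributes products, pulls scalars to the front and associates to the
    left: the result is a combination of monomials, ready for [lin]. *)
Definition nc_expand :=
  (@mulrDl A, @mulrDr A, @mulrBl A, @mulrBr A, @mulNr A, @mulrN A,
   fun a x y => esym (@scalerAl F A a x y),
   fun a x y => esym (@scalerAr F A a x y), @mulrA A).

(** Once expanded, the two sides differ by exactly the q-Serre polynomial. *)
Lemma serre_right (q : F) (x y : A) : q != 0 ->
    x * x * y - (q + q^-1) *: (x * y * x) + y * x * x = 0 ->
  (y * x - q^-1 *: (x * y)) * x = q *: (x * (y * x - q^-1 *: (x * y))).
Proof.
move=> q0 /eqP; rewrite addrC addr_eq0 => /eqP yxx.
by rewrite !nc_expand yxx; lin F; rewrite /=; field.
Qed.

Lemma serre_left (q : F) (x y : A) : q != 0 ->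
    x * x * y - (q + q^-1) *: (x * y * x) + y * x * x = 0 ->
  x * (x * y - q^-1 *: (y * x)) = q *: ((x * y - q^-1 *: (y * x)) * x).
Proof.
move=> q0 /eqP; rewrite addrC addr_eq0 => /eqP yxx.
by rewrite !nc_expand yxx; lin F; rewrite /=; field.
Qed.

End NCExpand.

(** * Intertwining relations for a triangular L-operator *)

Section TriangularRelations.

Variables (F : fieldType) (A : algType F) (q : F) (n : nat).
Variables (K KV : 'I_n -> A) (D : 'I_n -> 'I_n -> A) (G : 'I_n -> 'I_n -> A).

Local Notation z := (q - q^-1).

Hypotheses (q0 : q != 0) (z0 : z != 0) (q2 : q ^+ 2 + 1 != 0).
Hypotheses (KVK : forall i, KV i * K i = 1).
Hypotheses (DK : forall i, D i i = K i).
Hypotheses (D0 : forall b a : 'I_n, (b < a)%N -> D b a = 0).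
Hypotheses (KC : forall i j, K i * K j = K j * K i).
Hypothesis wtD : forall i a b : 'I_n, (a <= b)%N ->
  q ^+ (i == a) *: (K i * D b a) = q ^+ (i == b) *: (D b a * K i).
Hypothesis recD : forall a m b : 'I_n, (a < m < b)%N ->
  z *: (K m * D b a) = D b m * D m a - D m a * D b m.
Hypothesis farD : forall a b c d : 'I_n, b = a.+1 :> nat -> d = c.+1 :> nat ->
  (b < c)%N -> D b a * D d c = D d c * D b a.
Hypothesis serre_lo : forall a b c : 'I_n, b = a.+1 :> nat -> c = b.+1 :> nat ->
  D c a * D b a = q *: (D b a * D c a).
Hypothesis serre_hi : forall a b c : 'I_n, b = a.+1 :> nat -> c = b.+1 :> nat ->
  D c b * D c a = q *: (D c a * D c b).
Hypothesis wtG : forall i m m' : 'I_n, m' = m.+1 :> nat ->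
  q ^+ (i == m') *: (K i * G m m') = q ^+ (i == m) *: (G m m' * K i).
Hypothesis GD : forall m m' l l' : 'I_n, m' = m.+1 :> nat -> l' = l.+1 :> nat ->
  q *: (G m m' * D l' l - D l' l * G m m') =
  if m == l then z *: (K m * K m - K m' * K m') else 0.

(** The companion of [recD]: an identity for a root vector may be checked after multiplication by z
    K_m, where the root vector becomes a commutator. *)
Lemma K_cancel i u v : z *: (K i * u) = z *: (K i * v) -> u = v.
Proof.
move/(congr1 (fun x => z^-1 *: x)); rewrite !scalerA mulVf // !scale1r.
by move/(congr1 ( *%R (KV i))); rewrite !mulrA KVK !mul1r.
Qed.

(** The step of every induction on height: up to z K_m, D b a is a commutator of two shorter root
    vectors, and the scalars of q-commutation multiply. *)
Lemma rec_qcomm x (a m b : 'I_n) t1 t2 : (a < m < b)%N -> K m * x = x * K m ->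
    D b m * x = t1 *: (x * D b m) -> D m a * x = t2 *: (x * D m a) ->
  D b a * x = (t1 * t2) *: (x * D b a).
Proof.
move=> amb Kx bmx max; apply: (@K_cancel m).
rewrite -!scalerAr mulrA scalerAl recD // mulrA Kx -mulrA scalerA [z * _]mulrC.
rewrite -scalerA [z *: (x * _)]scalerAr recD // mulrBl mulrBr -!mulrA max bmx.
by rewrite -!scalerAr !mulrA max bmx -!scalerAl scalerBr !scalerA [t2 * _]mulrC.
Qed.

(** A root vector is built from the simple ones of its interval and the inverses of the K_c strictly
    inside, so commuting with these suffices. The induction splits at a + 1. *)
Lemma comm_D x (a b : 'I_n) : (a < b)%N ->
    (forall c d : 'I_n, d = c.+1 :> nat -> (a <= c)%N -> (d <= b)%N ->
       D d c * x = x * D d c) ->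
    (forall c : 'I_n, (a < c < b)%N -> K c * x = x * K c) ->
  D b a * x = x * D b a.
Proof.
move Dk: (b - a)%N => k; elim: k a Dk => [|k IHk] a Dk ab HD HK.
  by move/eqP: Dk; rewrite subn_eq0 leqNgt ab.
have [ba|ba] := eqVneq (b : nat) a.+1; first exact: HD.
have lt_c : (a.+1 < n)%N by apply: leq_trans (ltn_ord b); rewrite ltnS.
have lt_cb : (a.+1 < b)%N by rewrite ltn_neqAle eq_sym ba.
rewrite -[RHS]scale1r -[1]mulr1; apply: (@rec_qcomm _ _ (Ordinal lt_c)) => /=.
- by rewrite ltnSn.
- by apply: HK; rewrite /= ltnSn.
- rewrite scale1r; apply: IHk => //=; first by rewrite subnS Dk.
    by move=> c d dc ac db; apply: HD => //; apply: ltnW.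
  by move=> c /andP[ac cb]; apply: HK; rewrite cb (ltn_trans _ ac) //=.
- by rewrite scale1r; apply: HD => //=; rewrite ltnW.
Qed.

Lemma wtD_comm (i a b : 'I_n) : (a <= b)%N -> (i != a) -> (i != b) ->
  K i * D b a = D b a * K i.
Proof.
move=> ab /negPf ia /negPf ib; have := wtD i ab.
by rewrite ia ib !expr0 !scale1r.
Qed.

(** Two uses of [comm_D] reduce this to [farD]. An interval reduced to a point stands for some K_i
    and is settled by weights. *)
Lemma disjoint_comm (a b c d : 'I_n) : (a <= b < c)%N -> (c <= d)%N ->
  D d c * D b a = D b a * D d c.
Proof.
move=> /andP[ab bc] cd.
have ne (i j : 'I_n) : (i < j)%N -> (i != j) && (j != i).
  by move=> ij; rewrite -!val_eqE /= neq_ltn ij eq_sym neq_ltn ij.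
have bd : (b < d)%N by apply: leq_trans cd.
have [->|ncd] := eqVneq d c.
  rewrite DK wtD_comm //.
    by case/andP: (ne _ _ (leq_ltn_trans ab bc)).
  by case/andP: (ne _ _ bc).
have {cd ncd} cd : (c < d)%N by rewrite ltn_neqAle eq_sym ncd.
apply: comm_D => // [e f fe ce fd|e /andP[ce ed]]; last first.
  have be := ltn_trans bc ce; have ae := leq_ltn_trans ab be.
  by rewrite wtD_comm //; [case/andP: (ne _ _ ae)|case/andP: (ne _ _ be)].
have be : (b < e)%N by apply: leq_trans ce.
have ef : (e < f)%N by rewrite fe.
have [->|nab] := eqVneq a b.
  have bf := ltn_trans be ef.
  rewrite DK [RHS]wtD_comm //; first exact: ltnW.
    by case/andP: (ne _ _ be).
  by case/andP: (ne _ _ bf).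
have {ab nab} ab : (a < b)%N by rewrite ltn_neqAle nab.
apply/esym; apply: comm_D => // [g h hg ag hb|g /andP[ag gb]].
  apply: farD => //; exact: leq_ltn_trans be.
have ge := ltn_trans gb be; have gf := ltn_trans ge ef.
by rewrite wtD_comm //; [exact: ltnW|case/andP: (ne _ _ ge)|case/andP: (ne _ _ gf)].
Qed.

Lemma ord_neq (i j : 'I_n) : (i != j :> nat) -> (i == j) = false.
Proof. by rewrite val_eqE => /negPf. Qed.

Lemma D_K_src (a b : 'I_n) : (a < b)%N -> D b a * K a = q *: (K a * D b a).
Proof.
move=> ab; have := wtD a (ltnW ab); rewrite eqxx ord_neq; last by lia.
by rewrite expr0 expr1 scale1r => ->.
Qed.

Lemma D_K_tgt (a b : 'I_n) : (a < b)%N -> D b a * K b = q^-1 *: (K b * D b a).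
Proof.
move=> ab; have := wtD b (ltnW ab); rewrite eqxx ord_neq; last by lia.
by rewrite expr0 expr1 scale1r => ->; rewrite scalerA mulVf // scale1r.
Qed.

(** * Commutation with a simple root vector *)

Section SimpleRoot.

Variables m m' : 'I_n.
Hypothesis mm' : m' = m.+1 :> nat.

Let lt_mm' : (m < m')%N. Proof. by rewrite mm'. Qed.
Let le_mm' : (m <= m')%N := ltnW lt_mm'.
Let nm : (m == m') = false. Proof. by apply: ord_neq; lia. Qed.
Let nm' : (m' == m) = false. Proof. by apply: ord_neq; lia. Qed.

(** Splitting at m' + 1 leaves one piece disjoint from the simple root and one governed by the Serre
    relation, the source of the factor q. *)
Lemma D_F_src (b : 'I_n) : (m' < b)%N -> D b m * D m' m = q *: (D m' m * D b m).
Proof.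
move=> lt_b; have [bE|bne] := eqVneq (b : nat) m'.+1.
  exact: serre_lo.
have lt_c : (m'.+1 < n)%N by have := ltn_ord b; lia.
pose c := Ordinal lt_c; rewrite -[q]mul1r.
apply: (@rec_qcomm _ _ c) => /=; first by lia.
- by apply: wtD_comm => //; rewrite ord_neq //=; lia.
- by rewrite scale1r; apply: disjoint_comm => /=; lia.
- exact: serre_lo.
Qed.

Lemma D_F_tgt (a : 'I_n) : (a < m)%N -> D m' a * D m' m = q^-1 *: (D m' m * D m' a).
Proof.
have base (d : 'I_n) : m = d.+1 :> nat -> D m' d * D m' m = q^-1 *: (D m' m * D m' d).
  by move=> md; rewrite (serre_hi md mm') scalerA mulVf // scale1r.
move=> lt_a; have [aE|ane] := eqVneq (m : nat) a.+1; first exact: base.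
have lt_c : (m.-1 < n)%N by have := ltn_ord m; lia.
pose c := Ordinal lt_c; rewrite -[q^-1]mulr1.
apply: (@rec_qcomm _ _ c) => /=; first by lia.
- by apply: wtD_comm => //; rewrite ord_neq //=; lia.
- by apply: base => /=; lia.
- by rewrite scale1r; apply/esym; apply: disjoint_comm => /=; lia.
Qed.

Lemma D_F_next (b : 'I_n) : (m' < b)%N ->
  D b m' * D m' m = D m' m * D b m' + z *: (K m' * D b m).
Proof. by move=> lt_b; rewrite recD ?lt_mm' // addrC subrK. Qed.

Lemma D_F_prev (a : 'I_n) : (a < m)%N ->
  D m a * D m' m = D m' m * D m a - z *: (K m * D m' a).
Proof. by move=> lt_a; rewrite recD ?lt_a // subKr. Qed.

(* With y = D m' m, the two ways of writing D c d as a commutator give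
   D c d * y = q^-2 y * D c d + q^-1 [P, Q] and D c d * y = q^2 y * D c d - q [P, Q];
   adding q times the first to q^-1 times the second eliminates [P, Q]. *)
Lemma D_F_inner_base (d c : 'I_n) : m = d.+1 :> nat -> c = m'.+1 :> nat ->
  D c d * D m' m = D m' m * D c d.
Proof.
move=> md cm'.
have [lt_d lt_c] : (d < m)%N /\ (m' < c)%N by lia.
set y := D m' m; set P := D c m; set Q := D m' d; set X := D c d.
set w := D c m'; set x := D m d.
have Py : P * y = q *: (y * P) by apply: D_F_src.
have Qy : Q * y = q^-1 *: (y * Q) by apply: D_F_tgt.
have wy : w * y = y * w + z *: (K m' * P) by apply: D_F_next.
have xy : x * y = y * x - z *: (K m * Q) by apply: D_F_prev.
have yK : y * K m = q *: (K m * y) by apply: D_K_src.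
have yK' : y * K m' = q^-1 *: (K m' * y) by apply: D_K_tgt.
have PK : P * K m = q *: (K m * P) by apply: D_K_src; lia.
have QK' : Q * K m' = q^-1 *: (K m' * Q) by apply: D_K_tgt; lia.
have e1 : z *: (K m * X) = P * x - x * P by apply: recD; lia.
have e2 : z *: (K m' * X) = w * Q - Q * w by apply: recD; lia.
have f1 : X * y = q ^- 2 *: (y * X) + q^-1 *: (P * Q - Q * P).
  apply: (@K_cancel m').
  have -> : z *: (K m' * (q ^- 2 *: (y * X) + q^-1 *: (P * Q - Q * P))) =
      q^-1 *: (y * (w * Q - Q * w)) + (z / q) *: (K m' * (P * Q - Q * P)).
    rewrite -e2 -!scalerAr mulrA yK' !nc_expand.
    by lin F; rewrite /=; field.
  rewrite mulrA scalerAl e2 mulrBl -!mulrA Qy wy -!scalerAr mulrDr mulrA wy.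
  rewrite mulrA Qy -scalerAr [Q * (K m' * P)]mulrA QK' !nc_expand.
  by lin F; rewrite /=; field.
have f2 : X * y = q ^+ 2 *: (y * X) - q *: (P * Q - Q * P).
  apply: (@K_cancel m).
  have -> : z *: (K m * (q ^+ 2 *: (y * X) - q *: (P * Q - Q * P))) =
      q *: (y * (P * x - x * P)) - (z * q) *: (K m * (P * Q - Q * P)).
    rewrite -e1 -!scalerAr mulrA yK !nc_expand.
    by lin F; rewrite /=; field.
  rewrite mulrA scalerAl e1 mulrBl -!mulrA Py xy -!scalerAr mulrBr !mulrA Py xy.
  rewrite -scalerAr [P * (K m * Q)]mulrA PK !nc_expand.
  by lin F; rewrite /=; field.
have : (q + q^-1) *: (X * y) = (q + q^-1) *: (y * X).
  rewrite scalerDl {1}f1 f2.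
  by lin F; rewrite /=; field.
apply: scalerI; have -> : q + q^-1 = (q ^+ 2 + 1) / q by field.
by rewrite mulf_neq0 ?invr_neq0.
Qed.

(** The base case is extended downwards to a, then upwards to b; each time the piece split off is
    disjoint from the simple root. *)
Lemma D_F_inner (a b : 'I_n) : (a < m)%N -> (m' < b)%N -> D b a * D m' m = D m' m * D b a.
Proof.
move=> lt_a lt_b.
have lt_d : (m.-1 < n)%N by have := ltn_ord m; lia.
have lt_c : (m'.+1 < n)%N by have := ltn_ord b; lia.
pose d := Ordinal lt_d; pose c := Ordinal lt_c.
have Ca : D c a * D m' m = D m' m * D c a.
  have [->|ne] := eqVneq a d; first by apply: D_F_inner_base => /=; lia.
  have {}ne : (a != d :> nat) by rewrite val_eqE.
  rewrite -[RHS]scale1r -[1]mulr1.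
  apply: (@rec_qcomm _ _ d) => /=; first by rewrite /= in ne; lia.
  - by apply: wtD_comm => //; rewrite ord_neq //=; lia.
  - by rewrite scale1r; apply: D_F_inner_base => /=; lia.
  - by rewrite scale1r; apply/esym; apply: disjoint_comm => /=; rewrite /= in ne; lia.
have [->|ne] := eqVneq b c; first exact: Ca.
have {}ne : (b != c :> nat) by rewrite val_eqE.
rewrite -[RHS]scale1r -[1]mulr1.
apply: (@rec_qcomm _ _ c) => /=; first by rewrite /= in ne; lia.
- by apply: wtD_comm => //; rewrite ord_neq //=; lia.
- by rewrite scale1r; apply: disjoint_comm => /=; rewrite /= in ne; lia.
- by rewrite scale1r.
Qed.

Let K_G : K m * G m m' = q *: (G m m' * K m).
Proof. by have := wtG m mm'; rewrite eqxx nm expr0 expr1 scale1r. Qed.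

Let K'_G : K m' * G m m' = q^-1 *: (G m m' * K m').
Proof.
have := wtG m' mm'; rewrite eqxx nm' expr0 expr1 scale1r => <-.
by rewrite scalerA mulVf // scale1r.
Qed.

Lemma K_G_comm i : i != m -> i != m' -> K i * G m m' = G m m' * K i.
Proof.
by move=> /negPf im /negPf im'; have := wtG i mm'; rewrite im im' !expr0 !scale1r.
Qed.

Lemma G_F : G m m' * D m' m =
  D m' m * G m m' + (z / q) *: (K m * K m - K m' * K m').
Proof.
have := GD mm' mm'; rewrite eqxx => /(congr1 (fun x => q^-1 *: x)).
rewrite !scalerA mulVf // scale1r [q^-1 * _]mulrC => <-.
by rewrite addrC subrK.
Qed.

(** The interval from a to b may end at m or start at m' provided a < b: K_m and K_m' only q-commute
    with G. *)
Lemma D_G_outer (a b : 'I_n) : (a <= b)%N ->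
    (m' < a)%N || (b < m)%N || ((a < b)%N && ((m' == a) || (m == b))) ->
  D b a * G m m' = G m m' * D b a.
Proof.
move=> ab out; have [ba|ba] := eqVneq a b.
  have {}out : (m' < b)%N || (b < m)%N.
    by move: out; rewrite ba ltnn orbF.
  by rewrite ba DK K_G_comm // ord_neq //; lia.
have {}ab : (a < b)%N by rewrite ltn_neqAle ab andbT.
have {}out : (m' <= a)%N || (b <= m)%N.
  by move: out; rewrite -!val_eqE /= ab /=; lia.
apply: comm_D => // [c d dc ac db|c /andP[ac cb]].
  have := GD mm' dc; rewrite ord_neq; last by lia.
  move=> /(congr1 (fun x => q^-1 *: x)); rewrite scalerA mulVf // scale1r scaler0.
  by move/eqP; rewrite subr_eq0 => /eqP ->.
by rewrite K_G_comm // ord_neq //; lia.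
Qed.

(** In the notation of the proof, [g, [y, x]] = [[g, y], x], and [g, y] is the Cartan term of [G_F].
    As x commutes with K_m', only the part in K_m^2 survives. *)
Lemma D_G_tgt (a : 'I_n) : (a < m)%N ->
  q *: (D m' a * G m m') + z *: (D m a * K m) = G m m' * D m' a.
Proof.
move=> lt_a; apply: (@K_cancel m).
set g := G m m'; set y := D m' m; set x := D m a; set X := D m' a.
have e : z *: (K m * X) = y * x - x * y by apply: recD; lia.
have gx : g * x = x * g.
  by apply/esym; apply: D_G_outer; [exact: ltnW|rewrite lt_a eqxx !orbT].
have xK : x * K m = q^-1 *: (K m * x) by apply: D_K_tgt.
have xK' : x * K m' = K m' * x.
  by rewrite wtD_comm //; [lia|rewrite ord_neq //; lia..].
have gy : g * y = y * g + (z / q) *: (K m * K m - K m' * K m') by apply: G_F.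
have -> : z *: (K m * (q *: (X * g) + z *: (x * K m))) =
    q *: ((y * x - x * y) * g) + (z ^+ 2 / q) *: (K m * K m * x).
  rewrite -e xK !nc_expand.
  by lin F; rewrite /=; field.
have -> : z *: (K m * (g * X)) = q *: (g * (y * x - x * y)).
  by rewrite -e mulrA K_G !nc_expand; lin F; rewrite /=; field.
rewrite mulrBr !mulrA gx -[x * g * y]mulrA gy !nc_expand.
rewrite -[y * g * x]mulrA gx xK xK' !nc_expand.
rewrite -[K m * x * K m]mulrA xK -[K m' * x * K m']mulrA xK' !nc_expand.
by lin F; rewrite /=; field.
Qed.

(** The same double commutator, split at m': here w commutes with K_m, so only the part in K_m'^2
    survives. *)
Lemma D_G_src (b : 'I_n) : (m' < b)%N ->
  D b m * G m m' = q *: (G m m' * D b m) + z *: (K m' * D b m').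
Proof.
move=> lt_b; apply: (@K_cancel m').
set g := G m m'; set y := D m' m; set w := D b m'; set P := D b m.
have e : z *: (K m' * P) = w * y - y * w by apply: recD; lia.
have gw : g * w = w * g.
  by apply/esym; apply: D_G_outer; [exact: ltnW|rewrite lt_b eqxx !orbT].
have wK' : w * K m' = q *: (K m' * w) by apply: D_K_src.
have wK : w * K m = K m * w.
  by rewrite wtD_comm //; [lia|rewrite ord_neq //; lia..].
have gK' : g * K m' = q *: (K m' * g).
  by rewrite K'_G scalerA mulfV // scale1r.
have gy : g * y = y * g + (z / q) *: (K m * K m - K m' * K m') by apply: G_F.
have -> : z *: (K m' * (P * g)) = (w * y - y * w) * g.
  by rewrite -e !nc_expand.
have -> : z *: (K m' * (q *: (g * P) + z *: (K m' * w))) =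
    g * (w * y - y * w) + z ^+ 2 *: (K m' * K m' * w).
  by rewrite -e -scalerAr mulrA gK' !nc_expand; lin F; rewrite /=; field.
rewrite mulrBr !mulrA gw -[w * g * y]mulrA gy !nc_expand.
rewrite -[y * g * w]mulrA gw wK wK' !nc_expand.
rewrite -[K m * w * K m]mulrA wK -[K m' * w * K m']mulrA wK' !nc_expand.
by lin F; rewrite /=; field.
Qed.

(** The correction z K_m' w that [D_G_src] gives for P commutes with x, by weights and disjointness,
    so it drops out of the commutator of P and x. *)
Lemma D_G_inner (a b : 'I_n) : (a < m)%N -> (m' < b)%N ->
  D b a * G m m' = G m m' * D b a.
Proof.
move=> lt_a lt_b; apply: (@K_cancel m).
set g := G m m'; set w := D b m'; set P := D b m; set x := D m a.
have e : z *: (K m * D b a) = P * x - x * P by apply: recD; lia.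
have xg : x * g = g * x.
  by apply: D_G_outer; [exact: ltnW|rewrite lt_a eqxx !orbT].
have xK' : x * K m' = K m' * x.
  by rewrite wtD_comm //; [lia|rewrite ord_neq //; lia..].
have wx : w * x = x * w by apply: disjoint_comm; lia.
have Pg : P * g = q *: (g * P) + z *: (K m' * w) by apply: D_G_src.
rewrite mulrA scalerAl e.
have -> : z *: (K m * (g * D b a)) = q *: (g * (P * x - x * P)).
  by rewrite -e mulrA K_G !nc_expand; lin F; rewrite /=; field.
rewrite mulrBl -!mulrA xg Pg mulrA Pg !nc_expand xg xK' -[K m' * w * x]mulrA wx.
rewrite !nc_expand.
by lin F; rewrite /=; field.
Qed.

(** * The intertwining relations, entry by entry *)

Let position (i : 'I_n) :
  [\/ [/\ (i < m)%N, (i == m) = false & (i == m') = false], i = m, i = m'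
    | [/\ (m' < i)%N, (i == m) = false & (i == m') = false]].
Proof.
case: (ltngtP i m) => [lt_i|lt_i|/val_inj ->].
- by apply: Or41; split=> //; apply: ord_neq; lia.
- case: (ltngtP i m') => [|lt_i'|/val_inj ->]; [lia| |exact: Or43].
  by apply: Or44; split=> //; apply: ord_neq; lia.
- exact: Or42.
Qed.

Let scal0 := (expr0, expr1, scale1r, mul0r, mul1r, scale0r, addr0, mulr0, scaler0).

(** This is entry (a, b) of D^T phi'(F) = phi(F) D^T for the simple lowering element F, where phi
    and phi' are the images under the coproduct and its opposite. The power of q and the term in z
    on each side come from the two summands of that coproduct. *)
Lemma intertwine_F (a b : 'I_n) :
  q ^+ (b == m') *: (D b a * D m' m) + ((b == m)%:R * z) *: (D m' a * K m) =
  q ^+ (a == m) *: (D m' m * D b a) + ((a == m')%:R * z) *: (K m' * D b m).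
Proof.
have outer : (a <= b)%N -> (m' < a)%N || (b < m)%N ->
    D b a * D m' m = D m' m * D b a.
  move=> ab /orP[lt|lt]; first by apply: disjoint_comm; lia.
  by apply/esym; apply: disjoint_comm; lia.
case: (position a) => [[lta -> ->]|->|->|[lta -> ->]];
  case: (position b) => [[ltb -> ->]|->|->|[ltb -> ->]]; rewrite ?eqxx ?nm ?nm' ?scal0.
- have [ab|ba] := leqP a b; first by apply: outer; rewrite ?ltb ?orbT.
  by rewrite (D0 ba) mul0r mulr0.
- rewrite D_F_prev // wtD_comm ?subrK //; [lia|rewrite ord_neq //; lia|by rewrite nm].
- by rewrite D_F_tgt // scalerA mulfV // scale1r.
- exact: D_F_inner.
- by rewrite !(D0 ltb) mul0r mulr0 scaler0.
- by rewrite !DK D_K_src //; lin F; rewrite /=; field.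
- by [].
- by rewrite D_F_src.
- by rewrite (D0 (_ : b < m')%N) ?(D0 ltb) ?mul0r ?mulr0 ?scaler0 ?addr0 //; lia.
- by rewrite (D0 lt_mm') !DK KC mul0r mulr0 add0r.
- by rewrite !DK D_K_tgt //; lin F; rewrite /=; field.
- exact: D_F_next.
- by rewrite (D0 (_ : b < a)%N) ?mul0r ?mulr0 //; lia.
- by rewrite (D0 (_ : m < a)%N) ?(D0 lta) ?mul0r ?mulr0 ?scaler0 ?addr0 //; lia.
- by rewrite (D0 lta) mul0r mulr0 scaler0.
- have [ab|ba] := leqP a b; first by apply: outer; rewrite ?lta.
  by rewrite (D0 ba) mul0r mulr0.
Qed.

Lemma intertwine_G (a b : 'I_n) :
  q ^+ (b == m') *: (D b a * G m m') + ((b == m')%:R * z) *: (D m a * K m) =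
  q ^+ (a == m) *: (G m m' * D b a) + ((a == m)%:R * z) *: (K m' * D b m').
Proof.
case: (position a) => [[lta am am']|->|->|[lta am am']];
  case: (position b) => [[ltb bm bm']|->|->|[ltb bm bm']];
  rewrite ?am ?am' ?bm ?bm' ?eqxx ?nm ?nm' ?scal0.
- have [ab|ba] := leqP a b; first by apply: D_G_outer; rewrite ?ltb ?orbT.
  by rewrite (D0 ba) mul0r mulr0.
- by apply: D_G_outer; rewrite ?lta ?eqxx ?orbT // ltnW.
- exact: D_G_tgt.
- exact: D_G_inner.
- by rewrite (D0 ltb) (D0 (_ : b < m')%N) ?mul0r ?mulr0 ?scaler0 ?addr0 //; lia.
- by rewrite (D0 lt_mm') !DK K_G ?mulr0 ?scaler0 ?addr0.
(* The entry a = m, b = m', where the commutator of G with the simple D and its Cartan term appear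
   directly. *)
- rewrite !DK G_F; lin F; rewrite /=; try by field.
- exact: D_G_src.
- by rewrite (D0 (_ : b < m')%N) ?mul0r ?mulr0 //; lia.
- by rewrite (D0 lt_mm') mul0r mulr0.
- by rewrite (D0 lt_mm') !DK K'_G ?mul0r ?scaler0 ?addr0 // scalerA mulfV // scale1r.
- by apply: D_G_outer; rewrite ?ltb ?eqxx ?orbT // ltnW.
- by rewrite (D0 (_ : b < a)%N) ?mul0r ?mulr0 //; lia.
- by rewrite (D0 (_ : m < a)%N) ?mul0r ?mulr0 //; lia.
- by rewrite (D0 lta) (D0 (_ : m < a)%N) ?mul0r ?mulr0 ?scaler0 ?addr0 //; lia.
- have [ab|ba] := leqP a b; first by apply: D_G_outer; rewrite ?lta.
  by rewrite (D0 ba) mul0r mulr0.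
Qed.

End SimpleRoot.

(** * The antipode inverts the triangular matrix *)

Section Antipode.

Variable S : A -> A.
Hypotheses (S_linear : linear S) (SM : forall x y, S (x * y) = S y * S x).
Hypotheses (KKV : forall i, K i * KV i = 1) (SK : forall i, S (K i) = KV i).
Hypothesis SF : forall m m' : 'I_n, m' = m.+1 :> nat ->
  S (D m' m) = - q *: (D m' m * KV m * KV m').

Let S0 : S 0 = 0.
Proof.
have := S_linear 1 0 0; rewrite scaler0 addr0 scale1r => e.
by apply: (addrI (S 0)); rewrite addr0 -e.
Qed.

Let SZ c x : S (c *: x) = c *: S x.
Proof. by rewrite -[c *: x]addr0 S_linear S0 addr0. Qed.

Let SB x y : S (x - y) = S x - S y.
Proof. by rewrite addrC -scaleN1r S_linear scaleN1r addrC. Qed.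

Let SD_K (i a b : 'I_n) : (a <= b)%N -> i != a -> i != b ->
  K i * S (D b a) = S (D b a) * K i.
Proof.
move=> ab ia ib; have /(congr1 S) := wtD_comm ab ia ib; rewrite !SM SK => e.
rewrite -[RHS]mul1r -(KKV i) -mulrA [_ * (_ * K i)]mulrA -e -mulrA KVK.
by rewrite mulr1.
Qed.

Let SD_K_tgt (a b : 'I_n) : (a < b)%N ->
  S (D b a) * K b = q^-1 *: (K b * S (D b a)).
Proof.
move=> ab; have /(congr1 S) := D_K_tgt ab; rewrite SZ !SM SK => e.
rewrite -[LHS]mul1r -(KKV b) -mulrA [_ * (_ * K b)]mulrA e.
by rewrite -scalerAl -scalerAr -[_ * KV b * K b]mulrA KVK mulr1.
Qed.

(** Disjointness survives S: the image of D m' m is D m' m times inverse Cartan elements, which can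
    be stripped off because K_m and K_m' commute with S (D l i). *)
Let SD_F (i l m m' : 'I_n) : m' = m.+1 :> nat -> (i <= l < m)%N ->
  D m' m * S (D l i) = S (D l i) * D m' m.
Proof.
move=> mm' /andP[il lm].
have /(congr1 S) : D m' m * D l i = D l i * D m' m.
  by apply: disjoint_comm; lia.
rewrite !SM (SF mm') -scalerAr -scalerAl.
move/(congr1 (fun x => - q^-1 *: x)); rewrite !scalerA mulrNN mulVf // !scale1r.
set T := S (D l i); set X := D m' m * KV m * KV m' => TX.
have FE : D m' m = X * K m' * K m.
  by rewrite /X -(mulrA _ (KV m')) KVK mulr1 -mulrA KVK mulr1.
have KT : K m * T = T * K m by apply: SD_K; rewrite ?ord_neq //; lia.
have K'T : K m' * T = T * K m' by apply: SD_K; rewrite ?ord_neq //; lia.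
clearbody X; by rewrite FE !mulrA TX -[LHS]mulrA KT mulrA -[X * K m' * T]mulrA K'T mulrA.
Qed.

(** For i < j, triangularity reduces the claim to R j = - S (D j i) K_j, proved by induction on j.
    With l = j - 1, multiplication by z K_l turns R j into the commutator of D j l with R l plus one
    boundary term. *)
Lemma antipode_left i j : \sum_m S (D m i) * D j m = (i == j)%:R.
Proof.
pose R (j : 'I_n) := \sum_(m < n | (m < j)%N) S (D m i) * D j m.
have sumE (k : 'I_n) : \sum_m S (D m i) * D k m = R k + S (D k i) * K k.
  rewrite (bigID (fun m : 'I_n => (m < k)%N)) /= -/(R k); congr (_ + _).
  rewrite (bigD1 k) ?ltnn //= DK big1 ?addr0 // => m /andP[km mk].
  rewrite [D k m]D0 ?mulr0 //; rewrite -val_eqE /= in mk; lia.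
case: (ltngtP i j) => [lt_ij|gt_ij|/val_inj <-]; last 2 first.
- rewrite [in RHS]ord_neq ?gtn_eqF // big1 // => m _.
  case: (ltnP m i) => [mi|im]; first by rewrite D0 // S0 mul0r.
  by rewrite [D j m]D0 ?mulr0 //; lia.
- rewrite sumE DK SK KVK eqxx /R big1 ?add0r // => m mi.
  by rewrite D0 // S0 mul0r.
suff RE : R j = - (S (D j i) * K j).
  by rewrite sumE RE addNr ord_neq //; lia.
have RS (k l l' : 'I_n) : l' = l.+1 :> nat ->
    \sum_(m < n | (m < l')%N) S (D m i) * D k m =
    \sum_(m < n | (m < l)%N) S (D m i) * D k m + S (D l i) * D k l.
  move=> ll'; rewrite (bigD1 l) /= ?ll' // addrC; congr (_ + _).
  by apply: eq_bigl => m; rewrite -val_eqE /=; lia.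
have [N] := ubnP (j : nat); elim: N j lt_ij => // N IHN j lt_ij lt_j.
have lt_l : (j.-1 < n)%N by have := ltn_ord j; lia.
have [l jl] : exists l : 'I_n, j = l.+1 :> nat by exists (Ordinal lt_l) => /=; lia.
have FK : D j l * K l = q *: (K l * D j l) by apply: D_K_src; lia.
rewrite /R (RS _ l) //; case: (ltngtP i l) => [lt_il|gt_il|/val_inj eq_il]; first 1 last.
- lia.
- rewrite -eq_il in jl FK *; rewrite big1 ?add0r => [|m mi]; last first.
    by rewrite D0 // S0 mul0r.
  rewrite DK SK (SF jl) -scalerAl -(mulrA _ (KV j)) KVK mulr1 scaleNr opprK.
  rewrite -[D j i in LHS]mulr1 -(KKV i) !mulrA -(mulrA _ _ (K i)) FK.
  by rewrite -scalerAr !mulrA KVK mul1r -scalerAl.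
set T := S (D l i); set T' := S (D j i); set F' := D j l.
have TK : T * K l = q^-1 *: (K l * T) by apply: SD_K_tgt.
have Rl : R l = - (T * K l) by apply: IHN; lia.
(* The image of [recD] under S; moving T past K_l turns the commutator into a q-commutator. *)
have T'E : z *: (T' * K j) = F' * T - q *: (T * F').
  have : z *: (K l * D j i) = F' * D l i - D l i * F' by apply: recD; lia.
  move=> /(congr1 (fun x => S x * K l * K j)); rewrite SZ SB !SM SK (SF jl) -/F' -/T -/T'.
  rewrite -!scalerAl -(mulrA T') KVK mulr1 => ->.
  rewrite -scalerAr !mulrBl -!scalerAl.
  have KTj : T * K j = K j * T by rewrite SD_K ?ord_neq //; lia.
  have KK : T * K l * K j = q^-1 *: (K j * K l * T).
    by rewrite TK -scalerAl -!mulrA KTj !mulrA (KC l).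
  have -> : F' * KV l * KV j * T * K l * K j = q^-1 *: (F' * T).
    rewrite -!(mulrA (F' * KV l * KV j)) KK -!scalerAr -!mulrA.
    by rewrite (mulrA (KV j)) KVK mul1r (mulrA (KV l)) KVK mul1r.
  have -> : T * (F' * KV l * KV j) * K l * K j = T * F'.
    rewrite -!mulrA (KC l) [KV j * _]mulrA KVK mul1r KVK mulr1 //.
  by lin F; rewrite /=; field.
apply: (@K_cancel l).
rewrite mulrDr scalerDr mulr_sumr scaler_sumr.
rewrite (eq_bigr (fun m : 'I_n =>
  F' * (S (D m i) * D l m) - S (D m i) * D l m * F')); last first.
  move=> m lt_ml; case: (ltnP m i) => [mi|im].
    by rewrite D0 // S0 !(mul0r, mulr0, scaler0, subrr).
  rewrite mulrA SD_K ?ord_neq //; [|lia..].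
  rewrite -mulrA scalerAr recD; last by lia.
  by rewrite mulrBr !mulrA SD_F // im.
rewrite sumrB -mulr_sumr -mulr_suml -/(R l) Rl.
rewrite !mulrN mulNr opprK scalerN [z *: (K l * (T' * _))]scalerAr T'E TK.
rewrite -scalerAr (mulrA F') FK !nc_expand.
by lin F; rewrite /=; field.
Qed.

(** Forward substitution: equation k involves only indices j <= k, with the invertible coefficient
    K_k at j = k. *)
Lemma triangular_cancel (p : 'I_n -> A) :
  (forall k, \sum_j p j * D k j = 0) -> forall k, p k = 0.
Proof.
move=> pD k; have [N] := ubnP (k : nat); elim: N k => // N IHN k lt_k.
have := pD k; rewrite (bigD1 k) //= big1 => [|j jk].
  by rewrite addr0 DK => /(congr1 ( *%R^~ (KV k))); rewrite -mulrA KKV mulr1 mul0r.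
case: (ltngtP j k) => [lt_j|gt_j|/val_inj eq_jk].
- by rewrite IHN ?mul0r //; lia.
- by rewrite D0 ?mulr0.
- by rewrite eq_jk eqxx in jk.
Qed.

(** By [antipode_left], the difference of the two sides is annihilated by D on the right, hence zero
    by triangularity. *)
Lemma antipode_right i j : \sum_m D m i * S (D j m) = (i == j)%:R.
Proof.
apply/eqP; rewrite -subr_eq0; apply/eqP.
apply: (triangular_cancel (p := fun j => \sum_m D m i * S (D j m) - (i == j)%:R)).
move=> k; under eq_bigr do rewrite mulrBl mulr_suml.
rewrite sumrB exchange_big /=.
rewrite (eq_bigr (fun m => D m i * (m == k)%:R)); last first.
  move=> m _; rewrite -antipode_left mulr_sumr.
  by apply: eq_bigr => l _; rewrite mulrA.
rewrite (bigD1 k) //= eqxx mulr1 big1 ?addr0; last first.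
  by move=> m /negPf ->; rewrite mulr0.
rewrite (bigD1 i) //= eqxx mul1r big1 ?addr0 ?subrr //.
by move=> m; rewrite eq_sym => /negPf ->; rewrite mul0r.
Qed.

End Antipode.
End TriangularRelations.

(** * The L-operators of U_q(n) *)

Section RootVectors.

Variables (F : fieldType) (s : F) (n : nat).
Local Notation q := (s ^+ 2).
Local Notation z := (q - q^-1).
Hypotheses (s0 : s != 0) (z0 : z != 0) (q2 : q ^+ 2 + 1 != 0).

Local Notation uq := (uq s n).
Local Notation k := (@uq_k F s n).
Local Notation kV := (@uq_kV F s n).
Local Notation e := (@uq_e F s n).
Local Notation f := (@uq_f F s n).
Local Notation lo := (@simple_lo n).
Local Notation hi := (@simple_hi n).
Local Notation E := (@uq_E F s n).
Local Notation Ehat := (@uq_Ehat F s n).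

Let q0 : q != 0. Proof. by rewrite expf_neq0. Qed.

Lemma simple_roots (a b : 'I_n) : b = a.+1 :> nat ->
  exists i, a = lo i /\ b = hi i.
Proof.
move=> ba; have lt_i : (a < n.-1)%N by have := ltn_ord b; lia.
by exists (Ordinal lt_i); split; apply: val_inj.
Qed.

(** * Weights and the reordering of Cartan factors *)

Definition has_weight (x : uq) (w : 'I_n -> int) :=
  forall i, k i * x = s ^ w i *: (x * k i).

Lemma weight_mul x y w w' : has_weight x w -> has_weight y w' ->
  has_weight (x * y) (fun i => w i + w' i).
Proof.
move=> wx wy i; rewrite mulrA wx -scalerAl -[x * k i * y]mulrA wy -scalerAr mulrA scalerA.
by rewrite expfzDr.
Qed.

Lemma weight_scale c x w : has_weight x w -> has_weight (c *: x) w.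
Proof. by move=> wx i; rewrite -scalerAr wx -scalerAl !scalerA mulrC. Qed.

Lemma weight_sub x y w : has_weight x w -> has_weight y w ->
  has_weight (x - y) w.
Proof. by move=> wx wy i; rewrite mulrBr wx wy -scalerBr -mulrBl. Qed.

Lemma weight_ext x w w' : has_weight x w -> w =1 w' -> has_weight x w'.
Proof. by move=> wx ww' i; rewrite -ww'. Qed.

Lemma weight_qcomm x y w w' : has_weight x w -> has_weight y w' ->
  has_weight (qcomm x y) (fun i => w i + w' i).
Proof.
move=> wx wy; apply: weight_sub; first exact: weight_mul.
apply: weight_scale; apply: weight_ext (weight_mul wy wx) _ => i.
exact: addrC.
Qed.

Lemma conj_weight i x t : k i * x * kV i = t *: x -> k i * x = t *: (x * k i).
Proof.
by move=> kx; rewrite scalerAl -kx -[RHS]mulrA uq_kVK mulr1.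
Qed.

Lemma weight_f j : has_weight (f j) (fun i => (i == hi j)%:Z - (i == lo j)%:Z).
Proof.
move=> i; apply: conj_weight; have := uqpi_rel (rel_kf s i j).
by rewrite !uqpiME uq_cstE mulr_algl /uq_wt opprB.
Qed.

Lemma weight_e j : has_weight (e j) (fun i => (i == lo j)%:Z - (i == hi j)%:Z).
Proof.
move=> i; apply: conj_weight; have := uqpi_rel (rel_ke s i j).
by rewrite !uqpiME uq_cstE mulr_algl.
Qed.

Lemma weight_Edown (a d : nat) : (a + d.+1 < n)%N ->
  has_weight (uq_Edown s n a d)
    (fun i => (i == (a + d.+1)%N :> nat)%:Z - (i == a :> nat)%:Z).
Proof.
have wf m : (m.+1 < n)%N ->
    has_weight (nat_f s n m) (fun i => (i == m.+1 :> nat)%:Z - (i == m :> nat)%:Z).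
  move=> lt_m; rewrite /nat_f insubT; first by lia.
  by move=> lt_m'; apply: weight_ext (weight_f _) _ => i; rewrite -!val_eqE.
elim: d => [|d IHd] lt_n; first by apply: weight_ext (wf a _) _; rewrite ?addn1 // -addn1.
have lt_f : ((a + d.+1).+1 < n)%N by lia.
have lt_E : (a + d.+1 < n)%N by lia.
apply: weight_ext (weight_qcomm (wf _ lt_f) (IHd lt_E)) _.
by move=> i /=; rewrite -!addnS addrA subrK.
Qed.

Lemma weight_E (a b : 'I_n) : (a < b)%N ->
  has_weight (E b a) (fun i => (i == b)%:Z - (i == a)%:Z).
Proof.
move=> ab; rewrite /uq_E ltnNge (ltnW ab) ab /=.
have bE : (a + (b - a.+1).+1 = b)%N by lia.
have lt_n : (a + (b - a.+1).+1 < n)%N by rewrite bE.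
by apply: weight_ext (weight_Edown lt_n) _ => i /=; rewrite bE.
Qed.

Local Notation kk b a := (k b * k a).

Lemma kkC a b c d : kk a b * kk c d = kk c d * kk a b.
Proof. by apply: commrM; apply/commr_sym/commrM; apply: uq_kC. Qed.

Lemma kk_swap a b : kk a b = kk b a. Proof. exact: uq_kC. Qed.

Lemma weight_kk x w c d : has_weight x w ->
  x * kk d c = s ^ (- (w d + w c)) *: (kk d c * x).
Proof.
move=> wx; have -> : kk d c * x = s ^ (w d + w c) *: (x * kk d c).
  rewrite -mulrA wx -scalerAr (mulrA (k d) x) wx -scalerAl scalerA -(mulrA x).
  by rewrite -expfzDr // addrC.
by rewrite scalerA -expfzDr // addNr expr0z scale1r.
Qed.

Lemma kk_mul x w y a b c d : has_weight x w ->
  (kk b a * x) * (kk d c * y) =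
  s ^ (- (w d + w c)) *: (kk b a * kk d c * (x * y)).
Proof.
move=> wx; rewrite -[LHS]mulrA [x * _]mulrA (weight_kk _ _ wx).
by rewrite -scalerAl -scalerAr !mulrA.
Qed.

(** * The lower triangular L-operator *)

Definition Ekk (b a : 'I_n) : uq := (z * s^-1) *: (kk b a * E b a).

Lemma EhatE a b : a != b -> Ehat b a = Ekk b a.
Proof. by move=> ab; rewrite /uq_Ehat eq_sym (negPf ab). Qed.

Definition Kq (i : 'I_n) : uq := k i * k i.
Definition KqV (i : 'I_n) : uq := kV i * kV i.

Definition Dlow (b a : 'I_n) : uq := if (a <= b)%N then Ehat b a else 0.
Definition Gup (a b : 'I_n) : uq := Ehat a b.

Lemma Dlow_diag i : Dlow i i = Kq i.
Proof. by rewrite /Dlow leqnn /uq_Ehat eqxx expr2. Qed.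

Lemma Dlow_gt (b a : 'I_n) : (b < a)%N -> Dlow b a = 0.
Proof. by move=> ba; rewrite /Dlow leqNgt ba. Qed.

Lemma DlowE (a b : 'I_n) : (a < b)%N -> Dlow b a = Ekk b a.
Proof.
move=> ab; rewrite /Dlow ltnW // EhatE // -val_eqE /=; lia.
Qed.

Lemma Dlow_simple i : Dlow (hi i) (lo i) = (z * s^-1) *: (kk (hi i) (lo i) * f i).
Proof. by rewrite DlowE //= /Ekk (uq_E_simple s i).2. Qed.

Lemma Gup_simple i : Gup (lo i) (hi i) = (z * s^-1) *: (kk (lo i) (hi i) * e i).
Proof. by rewrite /Gup EhatE ?/Ekk ?(uq_E_simple s i).1 // -val_eqE /=; lia. Qed.

Lemma KqVK i : KqV i * Kq i = 1.
Proof. by rewrite /Kq -mulrA (mulrA (kV i) (k i)) uq_kVK mul1r uq_kVK. Qed.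

Lemma KqKV i : Kq i * KqV i = 1.
Proof. by rewrite /Kq -mulrA (mulrA (k i) (kV i)) uq_kK mul1r uq_kK. Qed.

Lemma KqC i j : Kq i * Kq j = Kq j * Kq i. Proof. exact: kkC. Qed.

Lemma KqKqVC i j : Kq i * KqV j = KqV j * Kq i.
Proof. by apply: commrM; apply/commr_sym/commrM; apply/commr_sym/uq_kkVC. Qed.

Lemma kk_weight b a x w : has_weight x w -> has_weight (kk b a * x) w.
Proof.
have kC i : k i * kk b a = kk b a * k i by apply: commrM; apply: uq_kC.
by move=> wx i; rewrite mulrA kC -mulrA wx -scalerAr mulrA.
Qed.

Lemma weight_Dlow (a b : 'I_n) : (a <= b)%N ->
  has_weight (Dlow b a) (fun i => (i == b)%:Z - (i == a)%:Z).
Proof.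
rewrite leq_eqVlt => /orP[/eqP/val_inj->|ab].
  move=> i; rewrite Dlow_diag subrr expr0z scale1r.
  by apply: commrM; apply: uq_kC.
by rewrite DlowE //; apply/weight_scale/kk_weight/weight_E.
Qed.

Lemma weight_Kq x w i : has_weight x w -> Kq i * x = q ^ w i *: (x * Kq i).
Proof.
move=> wx; rewrite /Kq -(mulrA (k i)) wx -scalerAr (mulrA (k i) x) wx -scalerAl scalerA.
by rewrite -(mulrA x) -expfzDr // exprnP exprz_exp; congr (s ^ _ *: _); lia.
Qed.

Lemma Kq_Dlow (i a b : 'I_n) : (a <= b)%N ->
  q ^+ (i == a) *: (Kq i * Dlow b a) = q ^+ (i == b) *: (Dlow b a * Kq i).
Proof.
move=> ab; rewrite (weight_Kq _ (weight_Dlow ab)) scalerA; congr (_ *: _).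
by rewrite ![q ^+ _]exprnP -expfzDr // addrC subrK.
Qed.

(** This explains the normalisation of [Ehat]: collecting the Cartan factors yields s in one order
    and s^-1 in the other, and their ratio absorbs the q^-1 of the q-commutator, leaving a plain
    commutator. *)
Lemma Dlow_rec (a m b : 'I_n) : (a < m < b)%N ->
  z *: (Kq m * Dlow b a) = Dlow b m * Dlow m a - Dlow m a * Dlow b m.
Proof.
move=> /andP[am mb]; have ab := ltn_trans am mb.
have ne (i j : 'I_n) : (i < j)%N -> ((i == j) = false) * ((j == i) = false).
  by move=> ij; split; rewrite -val_eqE /=; lia.
rewrite !DlowE // /Ekk -!scalerAl -!scalerAr !scalerA.
rewrite (kk_mul _ _ _ _ _ (weight_E mb)) (kk_mul _ _ _ _ _ (weight_E am)).
rewrite !eqxx !(ne _ _ am, ne _ _ mb, ne _ _ ab) /=.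
rewrite (kkC m a b m) (_ : kk b m * kk m a = Kq m * kk b a); last first.
  by rewrite /Kq [k b * k m]uq_kC -!mulrA [k b * _]mulrA [k b * k m]uq_kC !mulrA.
rewrite (@uq_E_rec _ _ _ b m a); last by rewrite am mb orbT.
rewrite !mulrBr !scalerBr -!scalerAr !scalerA !mulrA.
congr (_ *: _ - _ *: _).
- by rewrite [X in s ^ X](_ : _ = 1 :> int) ?expr1z; [field|lia].
- by rewrite [X in s ^ X](_ : _ = -1 :> int) ?exprN1; [field|lia].
Qed.

Let uqpi_lift := (@uqpiDE F s n, @uqpiME F s n, @uq_cstE F s n, mulr_algl, mulr_algr).

Lemma f_far (i j : 'I_n.-1) : (i.+1 < j)%N -> f i * f j = f j * f i.
Proof.
move=> ij; have /rel_far_f/uqpi_rel : (i.+1 < j)%N || (j.+1 < i)%N by rewrite ij.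
by move/(_ F s); rewrite !uqpiME.
Qed.

Lemma f_serre (i j : 'I_n.-1) : (i.+1 == j :> nat) || (j.+1 == i :> nat) ->
  f i * f i * f j - (q + q^-1) *: (f i * f j * f i) + f j * f i * f i = 0.
Proof.
move=> /rel_serre_f/uqpi_rel => /(_ F s).
by rewrite uqpi_serre uq_cstE scale0r.
Qed.

Lemma ef_comm (i j : 'I_n.-1) : e i * f j - f j * e i =
  ((i == j)%:R / z) *: (Kq (lo i) * KqV (hi i) - KqV (lo i) * Kq (hi i)).
Proof.
have := uqpi_rel (rel_ef s i j).
by rewrite /= !uqpi_lift !scaleN1r /Kq /KqV !mulrA.
Qed.

Lemma Dlow_far (a b c d : 'I_n) : b = a.+1 :> nat -> d = c.+1 :> nat ->
  (b < c)%N -> Dlow b a * Dlow d c = Dlow d c * Dlow b a.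
Proof.
move=> ba dc bc; have [i [ai bi]] := simple_roots ba.
have [j [cj dj]] := simple_roots dc; rewrite ai bi cj dj in ba dc bc *.
have ne (x y : 'I_n) : (x < y)%N -> ((x == y) = false) * ((y == x) = false).
  by move=> xy; split; rewrite -val_eqE /=; rewrite /= in xy; lia.
rewrite !Dlow_simple -!scalerAl -!scalerAr !scalerA.
rewrite (kk_mul _ _ _ _ _ (weight_f i)) (kk_mul _ _ _ _ _ (weight_f j)).
rewrite kkC f_far //; congr (_ *: (s ^ _ *: _)).
by rewrite -!val_eqE /= in bc *; lia.
Qed.

(** E c a is the q-commutator of f_j and f_i, so [serre_right] applies; the Cartan prefactors
    contribute the same power of s on both sides. *)
Lemma Dlow_serre_lo (a b c : 'I_n) : b = a.+1 :> nat -> c = b.+1 :> nat ->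
  Dlow c a * Dlow b a = q *: (Dlow b a * Dlow c a).
Proof.
move=> ba cb; have [i [ai bi]] := simple_roots ba.
have [j [bj cj]] := simple_roots cb.
have ne (x y : 'I_n) : (x < y)%N -> ((x == y) = false) * ((y == x) = false).
  by move=> xy; split; rewrite -val_eqE /=; lia.
have [ab bc ac] : [/\ (a < b)%N, (b < c)%N & (a < c)%N] by split; lia.
have ij : i.+1 = j :> nat by have := congr1 val bj; rewrite bi.
have Eba : E b a = f i by rewrite ai bi (uq_E_simple s i).2.
have Ecb : E c b = f j by rewrite bj cj (uq_E_simple s j).2.
have Ef : E c a * E b a = q *: (E b a * E c a).
  rewrite (@uq_E_rec _ _ _ c b a) ?Eba ?Ecb; last by lia.
  by apply: serre_right => //; apply: f_serre; rewrite ij eqxx.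
rewrite !DlowE // -!scalerAl -!scalerAr !scalerA.
rewrite (kk_mul _ _ _ _ _ (weight_E ac)) (kk_mul _ _ _ _ _ (weight_E ab)).
rewrite kkC Ef -scalerAr !scalerA !eqxx !(ne _ _ ab, ne _ _ bc, ne _ _ ac) /=.
by rewrite [_ * q]mulrC !mulrA.
Qed.

Lemma Dlow_serre_hi (a b c : 'I_n) : b = a.+1 :> nat -> c = b.+1 :> nat ->
  Dlow c b * Dlow c a = q *: (Dlow c a * Dlow c b).
Proof.
move=> ba cb; have [i [ai bi]] := simple_roots ba.
have [j [bj cj]] := simple_roots cb.
have ne (x y : 'I_n) : (x < y)%N -> ((x == y) = false) * ((y == x) = false).
  by move=> xy; split; rewrite -val_eqE /=; lia.
have [ab bc ac] : [/\ (a < b)%N, (b < c)%N & (a < c)%N] by split; lia.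
have ij : i.+1 = j :> nat by have := congr1 val bj; rewrite bi.
have Eba : E b a = f i by rewrite ai bi (uq_E_simple s i).2.
have Ecb : E c b = f j by rewrite bj cj (uq_E_simple s j).2.
have Ef : E c b * E c a = q *: (E c a * E c b).
  rewrite (@uq_E_rec _ _ _ c b a) ?Eba ?Ecb; last by lia.
  by apply: serre_left => //; apply: f_serre; rewrite ij eqxx orbT.
rewrite !DlowE // -!scalerAl -!scalerAr !scalerA.
rewrite (kk_mul _ _ _ _ _ (weight_E ac)) (kk_mul _ _ _ _ _ (weight_E bc)).
rewrite kkC Ef -scalerAr !scalerA !eqxx !(ne _ _ ab, ne _ _ bc, ne _ _ ac) /=.
by rewrite [_ * q]mulrC !mulrA.
Qed.

Lemma Gup_weight (m m' : 'I_n) : m' = m.+1 :> nat ->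
  has_weight (Gup m m') (fun i => (i == m)%:Z - (i == m')%:Z).
Proof.
move=> mm'; have [i [-> ->]] := simple_roots mm'; rewrite Gup_simple.
exact/weight_scale/kk_weight/weight_e.
Qed.

Lemma Kq_Gup (i m m' : 'I_n) : m' = m.+1 :> nat ->
  q ^+ (i == m') *: (Kq i * Gup m m') = q ^+ (i == m) *: (Gup m m' * Kq i).
Proof.
move=> mm'; rewrite (weight_Kq _ (Gup_weight mm')) scalerA; congr (_ *: _).
by rewrite ![q ^+ _]exprnP -expfzDr // addrC subrK.
Qed.

Lemma Gup_Dlow (m m' l l' : 'I_n) : m' = m.+1 :> nat -> l' = l.+1 :> nat ->
  q *: (Gup m m' * Dlow l' l - Dlow l' l * Gup m m') =
  if m == l then z *: (Kq m * Kq m - Kq m' * Kq m') else 0.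
Proof.
move=> mm' ll'; have [i [mi mi']] := simple_roots mm'.
have [j [lj lj']] := simple_roots ll'.
have eq_hi : (l' == m') = (l == m) by rewrite -!val_eqE /= mm' ll' eqSS.
have ijE : (m == l) = (i == j) by rewrite mi lj -!val_eqE.
rewrite {1 2}mi {1 2}mi' {1 2}lj {1 2}lj' Gup_simple Dlow_simple.
rewrite -!scalerAl -!scalerAr !scalerA.
rewrite (kk_mul _ _ _ _ _ (weight_e i)) (kk_mul _ _ _ _ _ (weight_f j)).
rewrite -mi -mi' -lj -lj' (kkC l' l).
(* Both orders of multiplication give the same power of s, so the commutator of e_i and f_j factors
   out. *)
have -> : - ((m == l')%:Z - (m == l)%:Z + ((m' == l')%:Z - (m' == l)%:Z)) =
          - ((l' == m)%:Z - (l' == m')%:Z + ((l == m)%:Z - (l == m')%:Z)).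
  by rewrite eq_hi ![m == _]eq_sym ![m' == _]eq_sym eq_hi; lia.
rewrite -!scalerBr -mulrBr ef_comm -ijE -scalerAr !scalerA.
have [eq_ml|_] := eqVneq m l; last by rewrite !mul0r !mulr0 scale0r.
have m'm : (m' == m) = false by rewrite -val_eqE /=; lia.
have eq_l' : l' = m' by apply/eqP; rewrite eq_hi eq_ml.
rewrite -eq_ml eq_l' !eqxx [m == m']eq_sym m'm -mi -mi' /=.
have -> : kk m m' * kk m' m = Kq m * Kq m'.
  have kK : k m' * k m' * k m = k m * (k m' * k m').
    by apply/commr_sym/commrM; apply: uq_kC.
  by rewrite /Kq -mulrA (mulrA (k m')) kK !mulrA.
rewrite [X in s ^ X](_ : _ = 0 :> int) ?expr0z; last by lia.
congr (_ *: _).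
  have scal (w : F) : w != 0 -> q * (w / s * (w / s) * 1) * (1 / w) = w.
    by move=> w0; field; rewrite w0 s0.
  exact: scal.
rewrite mulrBr; congr (_ - _).
  by rewrite KqKqVC mulrA -[_ * KqV m']mulrA KqKV mulr1.
by rewrite (KqC m) mulrA -[_ * KqV m]mulrA KqKV mulr1.
Qed.

(** * Antipode and intertwining relations for D *)

Local Notation S := (@antipode F s n).

Let qVq1 : q^-1 * q = 1. Proof. by rewrite mulVf. Qed.

Lemma antipodeM x y : S (x * y) = S y * S x.
Proof. exact: uq_antiM. Qed.

Lemma antipode_linear : linear S.
Proof. exact: uq_anti_linear. Qed.

Lemma antipodeZ c x : S (c *: x) = c *: S x.
Proof.
have S0 : S 0 = 0.
  have := antipode_linear 1 0 0; rewrite scaler0 addr0 scale1r => S0.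
  by apply: (addrI (S 0)); rewrite addr0 -S0.
by rewrite -[c *: x]addr0 antipode_linear S0 addr0.
Qed.

Lemma antipode_Kq i : S (Kq i) = KqV i.
Proof.
by have [_ _ Sk _] := @uq_anti_gen F s n _ _ qVq1; rewrite antipodeM /antipode !Sk.
Qed.

(** The weights of f_i at its two indices cancel, so f_i commutes with its Cartan prefactor; only
    the - q of S (f_i) and the inverted prefactor remain. *)
Lemma antipode_Dlow (m m' : 'I_n) : m' = m.+1 :> nat ->
  S (Dlow m' m) = - q *: (Dlow m' m * KqV m * KqV m').
Proof.
move=> mm'; have [i [-> ->]] := simple_roots mm'.
have [_ Sf Sk _] := @uq_anti_gen F s n _ _ qVq1.
have lh : (lo i == hi i) = false by rewrite -val_eqE /=; lia.
have hl : (hi i == lo i) = false by rewrite eq_sym.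
have fkk : f i * kk (hi i) (lo i) = kk (hi i) (lo i) * f i.
  rewrite (weight_kk _ _ (weight_f i)) !eqxx lh hl [X in s ^ X](_ : _ = 0 :> int).
    by rewrite expr0z scale1r.
  by lia.
rewrite Dlow_simple antipodeZ 2!antipodeM /antipode Sf !Sk -fkk.
rewrite -!scalerAl !scalerA mulrC; congr (_ *: _).
rewrite -!mulrA /KqV; congr (_ * _).
rewrite (mulrA (k (lo i))) uq_kK mul1r (mulrA (k (hi i))) uq_kkVC -mulrA.
by rewrite (mulrA (k (hi i))) uq_kK mul1r.
Qed.

Lemma antipode_Dlow_right i j :
  \sum_m Dlow m i * S (Dlow j m) = (i == j)%:R.
Proof.
exact: (antipode_right q0 z0 q2 KqVK Dlow_diag Dlow_gt KqC Kq_Dlow Dlow_rec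
  Dlow_far antipode_linear antipodeM KqKV antipode_Kq antipode_Dlow).
Qed.

Lemma antipode_Dlow_left i j :
  \sum_m S (Dlow m i) * Dlow j m = (i == j)%:R.
Proof.
exact: (antipode_left q0 z0 q2 KqVK Dlow_diag Dlow_gt KqC Kq_Dlow Dlow_rec
  Dlow_far antipode_linear antipodeM KqKV antipode_Kq antipode_Dlow).
Qed.

Lemma Dlow_intertwine_F (m m' : 'I_n) : m' = m.+1 :> nat -> forall a b,
  q ^+ (b == m') *: (Dlow b a * Dlow m' m) +
    ((b == m)%:R * z) *: (Dlow m' a * Kq m) =
  q ^+ (a == m) *: (Dlow m' m * Dlow b a) +
    ((a == m')%:R * z) *: (Kq m' * Dlow b m).
Proof.
exact: (intertwine_F q0 z0 q2 KqVK Dlow_diag Dlow_gt KqC Kq_Dlow Dlow_rec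
  Dlow_far Dlow_serre_lo Dlow_serre_hi).
Qed.

Lemma Dlow_intertwine_G (m m' : 'I_n) : m' = m.+1 :> nat -> forall a b,
  q ^+ (b == m') *: (Dlow b a * Gup m m') +
    ((b == m')%:R * z) *: (Dlow m a * Kq m) =
  q ^+ (a == m) *: (Gup m m' * Dlow b a) +
    ((a == m)%:R * z) *: (Kq m' * Dlow b m').
Proof.
exact: (intertwine_G q0 z0 q2 KqVK Dlow_diag Dlow_gt Kq_Dlow Dlow_rec
  Dlow_far Kq_Gup Gup_Dlow).
Qed.

(* uq_rev is the anti-automorphism exchanging e_i and f_i and fixing q^(E_ii/2),
   obtained as a morphism into the converse ring; it exchanges D and U. *)
Definition rev_cst (a : F) : uq^c := a%:A.

Fact rev_cst_is_zmod_morphism : zmod_morphism rev_cst.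
Proof. by move=> a b; rewrite /rev_cst scalerBl. Qed.

Fact rev_cst_is_monoid_morphism : monoid_morphism rev_cst.
Proof.
split=> [|a b]; first exact: scale1r.
by rewrite /rev_cst -[RHS]/((b%:A : uq) * (a%:A : uq)) mulr_algl scalerA mulrC.
Qed.

HB.instance Definition _ := GRing.isZmodMorphism.Build F uq^c rev_cst
  rev_cst_is_zmod_morphism.
HB.instance Definition _ := GRing.isMonoidMorphism.Build F uq^c rev_cst
  rev_cst_is_monoid_morphism.

Definition rev_gen (g : uq_gen n) : uq^c :=
  match g with
  | GenE i => f i
  | GenF i => e i
  | GenK i => k i
  | GenKV i => kV i
  end.

Definition uq_rev (x : uq) : uq := uq_eval rev_cst rev_gen (repr x).

Lemma kV_conj x w i : has_weight x w -> kV i * (x * k i) = s ^ (- w i) *: x.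
Proof.
move=> /(_ i) wx; have := congr1 (fun y => s ^ (- w i) *: (kV i * y)) wx.
rewrite mulrA uq_kVK mul1r -scalerAr scalerA -expfzDr // addNr expr0z scale1r.
by move=> <-.
Qed.

Lemma uq_revpi t : uq_rev (uqpi s t) = uq_eval rev_cst rev_gen t.
Proof.
apply: (@uq_eval_ueq F s n _ rev_cst rev_gen); last exact: ueq_repr.
  move=> a x; rewrite -[LHS]/((x : uq) * (a%:A : uq)) -[RHS]/((a%:A : uq) * (x : uq)).
  by rewrite mulr_algl mulr_algr.
move=> {}t u; case=> {t u} /=.
- by move=> i j; apply: uq_kC.
- by move=> i; rewrite rmorph1; apply: uq_kVK.
- by move=> i; rewrite rmorph1; apply: uq_kK.
(* Products in the converse ring are read backwards; [change] restates the relation with products of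
   [uq]. *)
- move=> i j; change (kV i * (f j * k i) = f j * (s ^ uq_wt i j)%:A).
  rewrite (kV_conj _ (weight_f j)) mulr_algr; congr (s ^ _ *: _).
  by rewrite opprB.
- move=> i j; change (kV i * (e j * k i) = e j * (s ^ - uq_wt i j)%:A).
  by rewrite (kV_conj _ (weight_e j)) mulr_algr.
- move=> i j.
  change (e j * f i + (f i * e j) * (-1)%:A =
    (kV (hi i) * (kV (hi i) * (k (lo i) * k (lo i))) +
     (k (hi i) * (k (hi i) * (kV (lo i) * kV (lo i)))) * (-1)%:A) *
      ((i == j)%:R / z)%:A).
  rewrite !mulr_algr !scaleN1r ef_comm eq_sym /Kq /KqV.
  case: eqP => [->|_]; last by rewrite mul0r !scale0r.
  congr (_ *: (_ - _)).
    by rewrite [RHS]mulrA; apply: KqKqVC.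
  by rewrite [RHS]mulrA; apply/esym; apply: KqKqVC.
- move=> i j ij.
  change (f j * (f i * f i) + f i * (f j * f i) * (- (q + q^-1))%:A
           + f i * (f i * f j) = 0%:A).
  rewrite mulr_algr scaleNr scale0r -(f_serre ij) !mulrA.
  by rewrite addrC addrA [RHS]addrAC.
- move=> i j ij.
  change (e j * (e i * e i) + e i * (e j * e i) * (- (q + q^-1))%:A
           + e i * (e i * e j) = 0%:A).
  have := uqpi_rel (rel_serre_e s ij).
  rewrite uqpi_serre uq_cstE scale0r mulr_algr scaleNr !mulrA => <-.
  by rewrite addrC addrA [RHS]addrAC.
- move=> i j ij; have := uqpi_rel (rel_far_f s ij).
  by rewrite !uqpiME => fij; exact: esym fij.
- move=> i j ij; have := uqpi_rel (rel_far_e s ij).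
  by rewrite !uqpiME => eij; exact: esym eij.
Qed.

Lemma uq_revM x y : uq_rev (x * y) = uq_rev y * uq_rev x.
Proof.
have [t ->] := uqpi_surj x; have [u ->] := uqpi_surj y.
by rewrite -uqpiME !uq_revpi.
Qed.

Lemma uq_rev_linear : linear uq_rev.
Proof.
move=> c x y; have [t ->] := uqpi_surj x; have [u ->] := uqpi_surj y.
rewrite -mulr_algl -uq_cstE -uqpiME -uqpiDE !uq_revpi /=.
by congr (_ + _); rewrite -[LHS]/((uq_eval rev_cst rev_gen t : uq) * c%:A) mulr_algr.
Qed.

Lemma uq_rev0 : uq_rev 0 = 0.
Proof.
have := uq_rev_linear 1 0 0; rewrite scaler0 addr0 scale1r => e0.
by apply: (addrI (uq_rev 0)); rewrite addr0 -e0.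
Qed.

Lemma uq_revZ c x : uq_rev (c *: x) = c *: uq_rev x.
Proof. by rewrite -[c *: x]addr0 uq_rev_linear uq_rev0 addr0. Qed.

Lemma uq_revD x y : uq_rev (x + y) = uq_rev x + uq_rev y.
Proof. by rewrite -{1}[x]scale1r uq_rev_linear scale1r. Qed.

Lemma uq_rev_sum (I : Type) (r : seq I) (P : pred I) (G : I -> uq) :
  uq_rev (\sum_(i <- r | P i) G i) = \sum_(i <- r | P i) uq_rev (G i).
Proof. exact: (big_morph _ uq_revD uq_rev0). Qed.

Lemma uq_rev1 : uq_rev 1 = 1.
Proof.
have -> : (1 : uq) = uqpi s (Cst 1) by rewrite uq_cstE scale1r.
by rewrite uq_revpi /= rmorph1 uq_cstE scale1r.
Qed.

Lemma uq_rev_gen :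
  [/\ forall i, uq_rev (e i) = f i, forall i, uq_rev (f i) = e i,
      forall i, uq_rev (k i) = k i & forall i, uq_rev (kV i) = kV i].
Proof. by split=> i; rewrite uq_revpi. Qed.

(** Exchanging e_i and f_i exchanges their two scalars, so reversal carries the antipode to its
    inverse. *)
Lemma uq_rev_anti a b : a * b = 1 -> b * a = 1 ->
  forall x, uq_rev (uq_anti a b x) = uq_anti b a (uq_rev x).
Proof.
move=> ab ba x; have [t ->] := uqpi_surj x.
rewrite (uq_antipi _ ab) !uq_revpi.
have [Se Sf Sk SkV] := @uq_anti_gen F s n _ _ ba.
elim: t => [c|g|t IHt u IHu|t IHt u IHu] /=.
- by rewrite /rev_cst -uq_cstE (uq_antipi _ ba).
- case: g => i /=; rewrite ?Se ?Sf ?Sk ?SkV //.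
    by rewrite -[LHS]/(f i * (- a)%:A) mulr_algr.
  by rewrite -[LHS]/(e i * (- b)%:A) mulr_algr.
- rewrite IHt IHu -[X in _ = uq_anti _ _ (X + _)]scale1r (@uq_anti_linear F s n _ _ ba).
  by rewrite scale1r.
- by rewrite IHt IHu; exact: esym (uq_antiM ba _ _).
Qed.

Lemma uq_revB x y : uq_rev (x - y) = uq_rev x - uq_rev y.
Proof. by rewrite addrC -scaleN1r uq_rev_linear scaleN1r addrC. Qed.

Lemma uq_rev_Edown (a d : nat) : uq_rev (uq_Edown s n a d) = uq_Eup s n a d.
Proof.
have [_ rf _ _] := uq_rev_gen.
have revf m : uq_rev (nat_f s n m) = nat_e s n m.
  by rewrite /nat_f /nat_e; case: insubP => [i _ _|_]; rewrite ?rf ?uq_rev0.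
elim: d => [|d IHd] /=; first exact: revf.
by rewrite /qcomm uq_revB uq_revZ !uq_revM IHd revf.
Qed.

Lemma uq_rev_Ehat (a b : 'I_n) : (a <= b)%N -> uq_rev (Ehat b a) = Ehat a b.
Proof.
have [_ _ rk _] := uq_rev_gen.
rewrite leq_eqVlt => /orP[/eqP/val_inj->|ab].
  by rewrite /uq_Ehat eqxx expr2 uq_revM rk.
have ba : b != a by rewrite -val_eqE /=; lia.
have a'b : a != b by rewrite eq_sym.
(* The weights at a and b are opposite, so the prefactor, which reversal moves to the right, can be
   put back in front. *)
have EK : E b a * kk a b = kk a b * E b a.
  rewrite (weight_kk _ _ (weight_E ab)) !eqxx (negPf ba) (negPf a'b).
  by rewrite [X in s ^ X](_ : _ = 0 :> int) ?expr0z ?scale1r //; lia.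
rewrite !EhatE // /Ekk [kk b a]kk_swap -EK uq_revZ !uq_revM !rk kk_swap.
congr (_ *: (_ * _)).
have -> : E b a = uq_Edown s n a (b - a.+1).
  by rewrite /uq_E ltnNge (ltnW ab) ab.
have -> : E a b = uq_Eup s n a (b - a.+1) by rewrite /uq_E ab.
exact: uq_rev_Edown.
Qed.

(** * The upper triangular L-operator, by reversal *)

Definition Uup (a b : 'I_n) : uq := if (a <= b)%N then Ehat a b else 0.

Lemma uq_rev_Dlow a b : uq_rev (Dlow b a) = Uup a b.
Proof.
rewrite /Dlow /Uup; case: ifP => [ab|_]; first exact: uq_rev_Ehat.
exact: uq_rev0.
Qed.

Lemma Gup_Uup (m m' : 'I_n) : m' = m.+1 :> nat -> Gup m m' = Uup m m'.
Proof. by move=> mm'; rewrite /Uup mm' leqnSn. Qed.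

Lemma uq_rev_Gup (m m' : 'I_n) : m' = m.+1 :> nat -> uq_rev (Gup m m') = Dlow m' m.
Proof.
move=> mm'; have [i [-> ->]] := simple_roots mm'.
have [re _ rk _] := uq_rev_gen.
have fkk : f i * kk (hi i) (lo i) = kk (hi i) (lo i) * f i.
  rewrite (weight_kk _ _ (weight_f i)) !eqxx [X in s ^ X](_ : _ = 0 :> int).
    by rewrite expr0z scale1r.
  rewrite [hi i == _]eq_sym (_ : lo i == hi i = false) //.
  by rewrite -val_eqE /=; lia.
by rewrite Gup_simple Dlow_simple uq_revZ !uq_revM re !rk fkk.
Qed.

Lemma uq_rev_Kq i : uq_rev (Kq i) = Kq i.
Proof. by have [_ _ rk _] := uq_rev_gen; rewrite uq_revM rk. Qed.

Lemma uq_revMK x i : uq_rev (x * Kq i) = Kq i * uq_rev x.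
Proof. by rewrite uq_revM uq_rev_Kq. Qed.

Lemma uq_revKM x i : uq_rev (Kq i * x) = uq_rev x * Kq i.
Proof. by rewrite uq_revM uq_rev_Kq. Qed.

Local Notation SV := (@antipodeV F s n).

(** Reversal swaps the factors of each product, so this left inverse for U comes from the right
    inverse for D. *)
Lemma antipodeV_Uup i j : \sum_m SV (Uup m i) * Uup j m = (i == j)%:R.
Proof.
have := congr1 uq_rev (antipode_Dlow_right j i); rewrite uq_rev_sum.
have -> : uq_rev (j == i)%:R = (i == j)%:R.
  by rewrite eq_sym; case: eqP => _; rewrite ?uq_rev1 ?uq_rev0.
move=> <-; apply: eq_bigr => m _; rewrite uq_revM uq_rev_Dlow.
rewrite /antipode uq_rev_anti ?uq_rev_Dlow //.
by rewrite mulfV.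
Qed.

Lemma Uup_intertwine_F (m m' : 'I_n) : m' = m.+1 :> nat -> forall a b,
  q ^+ (b == m') *: (Dlow m' m * Uup a b) +
    ((b == m')%:R * z) *: (Kq m * Uup a m) =
  q ^+ (a == m) *: (Uup a b * Dlow m' m) +
    ((a == m)%:R * z) *: (Uup m' b * Kq m').
Proof.
move=> mm' a b; have := congr1 uq_rev (Dlow_intertwine_G mm' a b).
by rewrite !uq_revD !uq_revZ !uq_revMK !uq_revKM !uq_revM !uq_rev_Dlow (uq_rev_Gup mm').
Qed.

Lemma Uup_intertwine_G (m m' : 'I_n) : m' = m.+1 :> nat -> forall a b,
  q ^+ (b == m') *: (Gup m m' * Uup a b) +
    ((b == m)%:R * z) *: (Kq m * Uup a m') =
  q ^+ (a == m) *: (Uup a b * Gup m m') +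
    ((a == m')%:R * z) *: (Uup m b * Kq m').
Proof.
move=> mm' a b; have := congr1 uq_rev (Dlow_intertwine_F mm' a b).
by rewrite !uq_revD !uq_revZ !uq_revMK !uq_revKM !uq_revM !uq_rev_Dlow (Gup_Uup mm').
Qed.

End RootVectors.

(** A subspace of maximal dimension inside P absorbs the line of any v in P. This links inductively
    generated predicates to irreducibility, which speaks of [{vspace V}]. *)
Lemma vspace_of_pred (F : fieldType) (V : vectType F) (P : V -> Prop) :
    P 0 -> (forall c u v, P u -> P v -> P (c *: u + v)) ->
  exists W : {vspace V}, forall v, v \in W <-> P v.
Proof.
move=> P0 PD.
pose Q d := `[< exists W : {vspace V}, (forall v, v \in W -> P v) /\ \dim W = d >].
have Q0 : exists d, Q d.
  exists 0%N; apply/asboolP; exists 0%VS; split=> [v|]; last exact: dimv0.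
  by rewrite memv0 => /eqP ->.
have Qmax d : Q d -> (d <= \dim (fullv : {vspace V}))%N.
  by move=> /asboolP[W [_ <-]]; apply/dimvS/subvf.
case: (ex_maxnP Q0 Qmax) => d /asboolP[W [WP dW]] max_d; exists W => v.
split=> [|Pv]; first exact: WP.
have : (\dim (<[v]> + W) <= \dim W)%N.
  rewrite dW; apply: max_d; apply/asboolP; exists (<[v]> + W)%VS; split=> // u.
  by move=> /memv_addP[x /vlineP[c ->] [w /WP Pw ->]]; apply: PD.
rewrite (geq_leqif (dimv_leqif_sup (addvSr _ _))) => /subvP; apply.
by apply: (subvP (addvSl _ _)); apply: memv_line.
Qed.

(** * The tensor product with the vector representation *)

Section Dressed.

Variables (F : fieldType) (s : F) (n : nat).
Local Notation q := (s ^+ 2).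
Local Notation z := (q - q^-1).
Hypotheses (s0 : s != 0) (z0 : z != 0) (q2 : q ^+ 2 + 1 != 0).
Local Notation uq := (uq s n).
Local Notation k := (@uq_k F s n).
Local Notation kV := (@uq_kV F s n).
Local Notation Kq := (@Kq F s n).
Local Notation KqV := (@KqV F s n).
Local Notation Dlow := (@Dlow F s n).
Local Notation Uup := (@Uup F s n).
Local Notation Gup := (@Gup F s n).

(** The common shape of the coproduct of a generator with one factor in the vector representation: a
    diagonal matrix tensor x, plus a matrix unit tensor t. *)
Definition step_mx (c : 'I_n -> F) (x t : uq) (p r : 'I_n) : 'M[uq]_n :=
  \matrix_(i, j) (((i == j)%:R * c i) *: x + ((i == p) && (j == r))%:R *: t).

Lemma mul_step_mx (N : 'M[uq]_n) c x t p r i j :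
  (N *m step_mx c x t p r) i j =
  c j *: (N i j * x) + (j == r)%:R *: (N i p * t).
Proof.
rewrite mxE; under eq_bigr do rewrite mxE mulrDr -!scalerAr.
rewrite big_split /=; congr (_ + _).
  rewrite (bigD1 j) //= eqxx mul1r big1 ?addr0 // => l /negPf ->.
  by rewrite mul0r scale0r.
rewrite (bigD1 p) //= eqxx big1 ?addr0 // => l /negPf ->.
by rewrite scale0r.
Qed.

Lemma step_mx_mul (N : 'M[uq]_n) c x t p r i j :
  (step_mx c x t p r *m N) i j =
  c i *: (x * N i j) + (i == p)%:R *: (t * N r j).
Proof.
rewrite mxE; under eq_bigr do rewrite mxE mulrDl -!scalerAl.
rewrite big_split /=; congr (_ + _).
  rewrite (bigD1 i) //= eqxx mul1r big1 ?addr0 // => l.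
  by rewrite eq_sym => /negPf ->; rewrite mul0r scale0r.
rewrite (bigD1 r) //= eqxx andbT big1 ?addr0 // => l /negPf ->.
by rewrite andbF scale0r.
Qed.

Definition DT : 'M[uq]_n := \matrix_(i, j) Dlow j i.
Definition UT : 'M[uq]_n := \matrix_(i, j) Uup j i.

(* phiF m m', phiG m m', phik l and phikV l are the images under
   (vector representation (x) id) o Delta of Ehat_(m'm), Ehat_(mm'), q^(E_ll/2) and
   q^(-E_ll/2), where m' = m + 1; phiF' and phiG' use the opposite coproduct. *)
Definition phiF (m m' : 'I_n) :=
  step_mx (fun i => q ^+ (i == m)) (Dlow m' m) (z *: Kq m') m' m.
Definition phiF' (m m' : 'I_n) :=
  step_mx (fun i => q ^+ (i == m')) (Dlow m' m) (z *: Kq m) m' m.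
Definition phiG (m m' : 'I_n) :=
  step_mx (fun i => q ^+ (i == m)) (Gup m m') (z *: Kq m') m m'.
Definition phiG' (m m' : 'I_n) :=
  step_mx (fun i => q ^+ (i == m')) (Gup m m') (z *: Kq m) m m'.
Definition phik (l : 'I_n) :=
  step_mx (fun i => s ^ (i == l)%:Z) (k l) 0 l l.
Definition phikV (l : 'I_n) :=
  step_mx (fun i => s ^ (- (i == l)%:Z)) (kV l) 0 l l.

Inductive dressed : 'M[uq]_n -> Prop :=
  | dressedF (m m' : 'I_n) of m' = m.+1 :> nat : dressed (phiF m m')
  | dressedG (m m' : 'I_n) of m' = m.+1 :> nat : dressed (phiG m m')
  | dressed_k l : dressed (phik l)
  | dressed_kV l : dressed (phikV l).

Lemma DT_phiF (m m' : 'I_n) : m' = m.+1 :> nat -> DT *m phiF' m m' = phiF m m' *m DT.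
Proof.
move=> mm'; apply/matrixP => a b; rewrite mul_step_mx step_mx_mul !mxE.
rewrite -scalerAr -scalerAl !scalerA.
exact: Dlow_intertwine_F.
Qed.

Lemma DT_phiG (m m' : 'I_n) : m' = m.+1 :> nat -> DT *m phiG' m m' = phiG m m' *m DT.
Proof.
move=> mm'; apply/matrixP => a b; rewrite mul_step_mx step_mx_mul !mxE.
rewrite -scalerAr -scalerAl !scalerA.
exact: Dlow_intertwine_G.
Qed.

Lemma UT_phiF (m m' : 'I_n) : m' = m.+1 :> nat -> phiF' m m' *m UT = UT *m phiF m m'.
Proof.
move=> mm'; apply/matrixP => b a; rewrite mul_step_mx step_mx_mul !mxE.
rewrite -scalerAr -scalerAl !scalerA.
exact: Uup_intertwine_F.
Qed.

Lemma UT_phiG (m m' : 'I_n) : m' = m.+1 :> nat -> phiG' m m' *m UT = UT *m phiG m m'.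
Proof.
move=> mm'; apply/matrixP => b a; rewrite mul_step_mx step_mx_mul !mxE.
rewrite -scalerAr -scalerAl !scalerA.
exact: Uup_intertwine_G.
Qed.

Lemma Dlow_k l a b :
  s ^ (b == l)%:Z *: (Dlow b a * k l) = s ^ (a == l)%:Z *: (k l * Dlow b a).
Proof.
case: (leqP a b) => [ab|ba]; last by rewrite Dlow_gt // mul0r mulr0 !scaler0.
rewrite (weight_Dlow s0 z0 q2 ab) scalerA -expfzDr //.
by rewrite ![l == _]eq_sym addrC subrK.
Qed.

Lemma Dlow_kV l a b :
  s ^ (- (b == l)%:Z) *: (Dlow b a * kV l) =
  s ^ (- (a == l)%:Z) *: (kV l * Dlow b a).
Proof.
pose c := s ^ (- (b == l)%:Z - (a == l)%:Z).
have := congr1 (fun x => c *: (kV l * x * kV l)) (Dlow_k l a b).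
rewrite /c -!scalerAr -!scalerAl !scalerA -!expfzDr // !mulrA uq_kVK mul1r.
rewrite -!mulrA uq_kK mulr1 => e.
rewrite (_ : - (a == l)%:Z = - (b == l)%:Z - (a == l)%:Z + (b == l)%:Z) ?e; last by lia.
by congr (s ^ _ *: _); lia.
Qed.

Lemma Uup_k l a b :
  s ^ (b == l)%:Z *: (k l * Uup a b) = s ^ (a == l)%:Z *: (Uup a b * k l).
Proof.
have [_ _ rk _] := uq_rev_gen n s0; have := congr1 (@uq_rev F s n) (Dlow_k l a b).
by rewrite !(uq_revZ s0) !(uq_revM s0) !rk !(uq_rev_Dlow s0 z0 q2).
Qed.

Lemma Uup_kV l a b :
  s ^ (- (b == l)%:Z) *: (kV l * Uup a b) =
  s ^ (- (a == l)%:Z) *: (Uup a b * kV l).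
Proof.
have [_ _ _ rk] := uq_rev_gen n s0; have := congr1 (@uq_rev F s n) (Dlow_kV l a b).
by rewrite !(uq_revZ s0) !(uq_revM s0) !rk !(uq_rev_Dlow s0 z0 q2).
Qed.

Definition Ymx := DT *m UT.

(** [UT] passes from the coproduct to its opposite and [DT] passes back; on the group-like Cartan
    generators the two coproducts agree. *)
Lemma Ymx_dressed N : dressed N -> Ymx *m N = N *m Ymx.
Proof.
rewrite /Ymx; case=> [m m' mm'|m m' mm'|l|l].
- by rewrite -mulmxA -UT_phiF // mulmxA DT_phiF // mulmxA.
- by rewrite -mulmxA -UT_phiG // mulmxA DT_phiG // mulmxA.
- have DTk : DT *m phik l = phik l *m DT.
    apply/matrixP => a b; rewrite mul_step_mx step_mx_mul !mxE.
    by rewrite mulr0 mul0r !scaler0 !addr0 Dlow_k.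
  have UTk : phik l *m UT = UT *m phik l.
    apply/matrixP => b a; rewrite mul_step_mx step_mx_mul !mxE.
    by rewrite mulr0 mul0r !scaler0 !addr0 Uup_k.
  by rewrite -mulmxA -UTk mulmxA DTk mulmxA.
- have DTk : DT *m phikV l = phikV l *m DT.
    apply/matrixP => a b; rewrite mul_step_mx step_mx_mul !mxE.
    by rewrite mulr0 mul0r !scaler0 !addr0 Dlow_kV.
  have UTk : phikV l *m UT = UT *m phikV l.
    apply/matrixP => b a; rewrite mul_step_mx step_mx_mul !mxE.
    by rewrite mulr0 mul0r !scaler0 !addr0 Uup_kV.
  by rewrite -mulmxA -UTk mulmxA DTk mulmxA.
Qed.

Definition Xmx : 'M[uq]_n :=
  (\matrix_(i, m) antipodeV (Uup m i)) *m (\matrix_(m, j) antipode (Dlow j m)).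

Lemma Xmx_Ymx : Xmx *m Ymx = 1%:M.
Proof.
rewrite /Xmx /Ymx -mulmxA (mulmxA _ DT).
have -> : (\matrix_(m, j) antipode (Dlow j m)) *m DT = 1%:M.
  apply/matrixP => i j; rewrite !mxE -(antipode_Dlow_left s0 z0 q2).
  by apply: eq_bigr => m _; rewrite !mxE.
rewrite mul1mx; apply/matrixP => i j; rewrite !mxE -(antipodeV_Uup s0 z0 q2).
by apply: eq_bigr => m _; rewrite !mxE.
Qed.

Lemma antipodeV0 : antipodeV (0 : uq) = 0.
Proof.
have ab1 : q * q^-1 = 1 by rewrite mulfV // expf_neq0.
have := @uq_anti_linear F s n _ _ ab1 1 0 0; rewrite scaler0 addr0 scale1r => S0.
by apply: (addrI (uq_anti q q^-1 0)); rewrite addr0 -S0.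
Qed.

Lemma uq_AE : uq_A s n = \matrix_(i, j) (z^-1 *: ((i == j)%:R - Xmx i j)).
Proof.
apply/matrixP => i j; rewrite !mxE; congr (_ *: (_ - _)).
(* Outside the range m <= min(i, j) one of the two triangular factors is zero. *)
rewrite [RHS](bigID (fun m : 'I_n => (m <= i)%N && (m <= j)%N)) /=.
rewrite [X in _ = _ + X]big1 ?addr0 => [|m].
  by apply: eq_bigr => m /andP[mi mj]; rewrite !mxE /Uup /Dlow mi mj.
rewrite !mxE /Uup /Dlow negb_and => /orP[/negPf->|/negPf ->].
  by rewrite antipodeV0 mul0r.
by rewrite -[X in antipode X](scale0r 0) (antipodeZ s0) scale0r mulr0.
Qed.


(** * Operator matrices acting on C^n (x) V *)

Variables (V : vectType F) (M : uq_module s n V).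

Local Notation vec := {ffun 'I_n -> V}.

Lemma actD x u v : M x (u + v) = M x u + M x v.
Proof. by have := uq_act_linearr M x 1 u v; rewrite !scale1r. Qed.

Lemma act0 x : M x 0 = 0.
Proof. by apply: (addrI (M x 0)); rewrite -actD !addr0. Qed.

Lemma actZ x c u : M x (c *: u) = c *: M x u.
Proof. by have := uq_act_linearr M x c u 0; rewrite act0 !addr0. Qed.

Lemma act_sum x (I : finType) (u : I -> V) : M x (\sum_i u i) = \sum_i M x (u i).
Proof. exact: (big_morph _ (actD x) (act0 x)). Qed.

Lemma act_addl x y v : M (x + y) v = M x v + M y v.
Proof. by have := uq_act_linearl M v 1 x y; rewrite !scale1r. Qed.

Lemma act_0l v : M 0 v = 0.
Proof. by apply: (addrI (M 0 v)); rewrite -act_addl !addr0. Qed.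

Lemma act_scalel c x v : M (c *: x) v = c *: M x v.
Proof. by have := uq_act_linearl M v c x 0; rewrite act_0l !addr0. Qed.

Lemma act_suml (I : finType) (x : I -> uq) v : M (\sum_i x i) v = \sum_i M (x i) v.
Proof. exact: (big_morph (fun x => M x v) (fun x y => act_addl x y v) (act_0l v)). Qed.

Definition mact (N : 'M[uq]_n) (w : vec) : vec := [ffun i => \sum_j M (N i j) (w j)].

Definition tens (j : 'I_n) (u : V) : vec := [ffun i => if i == j then u else 0].

Lemma mactM N P w : mact (N *m P) w = mact N (mact P w).
Proof.
apply/ffunP => i; rewrite !ffunE.
under eq_bigr do rewrite mxE act_suml.
rewrite exchange_big /=; apply: eq_bigr => k' _.
by rewrite ffunE act_sum; apply: eq_bigr => j _; rewrite uq_actM.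
Qed.

Lemma mact_linear N c u v : mact N (c *: u + v) = c *: mact N u + mact N v.
Proof.
apply/ffunP => i; rewrite !ffunE scaler_sumr -big_split.
by apply: eq_bigr => j _; rewrite !ffunE actD actZ.
Qed.

Lemma mact0 N : mact N 0 = 0.
Proof.
by apply/ffunP => i; rewrite !ffunE big1 // => j _; rewrite ffunE act0.
Qed.

Lemma mactZ N c u : mact N (c *: u) = c *: mact N u.
Proof. by rewrite -[c *: u]addr0 mact_linear mact0 addr0. Qed.

Lemma mactD N u v : mact N (u + v) = mact N u + mact N v.
Proof. by rewrite -{1}[u]scale1r mact_linear scale1r. Qed.

Lemma mactB N u v : mact N (u - v) = mact N u - mact N v.
Proof. by rewrite addrC -scaleN1r mact_linear scaleN1r addrC. Qed.

Lemma mact1 w : mact 1%:M w = w.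
Proof.
apply/ffunP => i; rewrite !ffunE (bigD1 i) //= mxE eqxx uq_act1 big1 ?addr0 //.
by move=> j; rewrite eq_sym mxE => /negPf ->; apply: act_0l.
Qed.

Lemma mact_tens N j u i : mact N (tens j u) i = M (N i j) u.
Proof.
rewrite ffunE (bigD1 j) //= ffunE eqxx big1 ?addr0 // => l /negPf lj.
by rewrite ffunE lj act0.
Qed.

Lemma tens_linear j c u v : tens j (c *: u + v) = c *: tens j u + tens j v.
Proof.
by apply/ffunP => i; rewrite !ffunE; case: eqP => _; rewrite ?scaler0 ?addr0.
Qed.

Lemma tens0 j : tens j 0 = 0.
Proof. by apply/ffunP => i; rewrite !ffunE; case: eqP. Qed.

Lemma tensZ j c u : tens j (c *: u) = c *: tens j u.
Proof. by rewrite -[c *: u]addr0 tens_linear tens0 addr0. Qed.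

Lemma tens_sum (w : vec) : w = \sum_j tens j (w j).
Proof.
apply/ffunP => i; rewrite sum_ffunE (bigD1 i) //= ffunE eqxx big1 ?addr0 //.
by move=> j; rewrite ffunE eq_sym => /negPf ->.
Qed.

Lemma step_tens c x t p r j u :
  mact (step_mx c x t p r) (tens j u) =
  c j *: tens j (M x u) + (j == r)%:R *: tens p (M t u).
Proof.
apply/ffunP => i; rewrite mact_tens mxE !ffunE act_addl !act_scalel.
congr (_ + _).
  by case: eqP => [->|_]; rewrite ?mul1r // mul0r scale0r scaler0.
by case: (i == p); rewrite ?scaler0 //= scale0r.
Qed.

(** * Submodules of C^n (x) V *)

Inductive submod (P : vec -> Prop) : vec -> Prop :=
  | submod_base w of P w : submod P w
  | submod0 : submod P 0
  | submod_lin c u v of submod P u & submod P v : submod P (c *: u + v)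
  | submod_act N u of dressed N & submod P u : submod P (mact N u).

Lemma submodZ P c u : submod P u -> submod P (c *: u).
Proof. by move=> Pu; rewrite -[c *: u]addr0; apply: submod_lin => //; apply: submod0. Qed.

Lemma submodD P u v : submod P u -> submod P v -> submod P (u + v).
Proof. by move=> Pu; rewrite -[u]scale1r; apply: submod_lin. Qed.

Lemma submodB P u v : submod P u -> submod P v -> submod P (u - v).
Proof. by move=> Pu Pv; apply: submodD => //; rewrite -scaleN1r; apply: submodZ. Qed.

Lemma submod_sum P (w : 'I_n -> vec) :
  (forall i, submod P (w i)) -> submod P (\sum_i w i).
Proof.
move=> Pw; elim/big_ind: _ => //; first exact: submod0.
by move=> u v; apply: submodD.
Qed.

Lemma submod_mono (P P' : vec -> Prop) w :
  (forall w, P w -> P' w) -> submod P w -> submod P' w.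
Proof.
move=> PP'; elim=> {w} [w /PP'|||].
- exact: submod_base.
- exact: submod0.
- by move=> c u v _ Pu _ Pv; apply: submod_lin.
- by move=> N u dN _; apply: submod_act.
Qed.

(** Z - c is a module endomorphism, so a containment checked on generators extends to the submodule
    they generate. *)
Lemma submod_commuting (P P' : vec -> Prop) (Z : 'M[uq]_n) c w :
    (forall N, dressed N -> Z *m N = N *m Z) ->
    (forall w, P w -> submod P' (mact Z w - c *: w)) ->
  submod P w -> submod P' (mact Z w - c *: w).
Proof.
move=> ZN ZP; elim=> {w} [w /ZP //||d u v _ Pu _ Pv|N u dN _ Pu].
- by rewrite mact0 scaler0 subr0; apply: submod0.
- rewrite mact_linear scalerDr opprD addrACA scalerA [c * d]mulrC -scalerA.
  by rewrite -scalerBr; apply: submod_lin.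
- rewrite -mactM ZN // mactM -mactZ -mactB; exact: submod_act.
Qed.

Lemma submod_phik P l j u : submod P (tens j u) -> submod P (tens j (M (k l) u)).
Proof.
move=> Pu; have := submod_act (dressed_k l) Pu.
rewrite step_tens act_0l tens0 scaler0 addr0 => /(submodZ (s ^ (- (j == l)%:Z))).
by rewrite scalerA -expfzDr // addNr expr0z scale1r.
Qed.

Lemma submod_phikV P l j u : submod P (tens j u) -> submod P (tens j (M (kV l) u)).
Proof.
move=> Pu; have := submod_act (dressed_kV l) Pu.
rewrite step_tens act_0l tens0 scaler0 addr0 => /(submodZ (s ^ (j == l)%:Z)).
by rewrite scalerA -expfzDr // addrN expr0z scale1r.
Qed.

Lemma submod_Kq P l j u : submod P (tens j u) -> submod P (tens j (M (Kq l) u)).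
Proof. by move=> Pu; rewrite uq_actM; do 2!apply: submod_phik. Qed.

Lemma submod_KqV P l j u : submod P (tens j u) -> submod P (tens j (M (KqV l) u)).
Proof. by move=> Pu; rewrite uq_actM; do 2!apply: submod_phikV. Qed.


(** Besides a multiple of e_j (x) D u, the coproduct yields at most one cross term, a multiple of
    e_m' (x) K_m' u. Asking for all j at once makes that term available. *)
Lemma submod_F P (m m' : 'I_n) u : m' = m.+1 :> nat ->
    (forall j, submod P (tens j u)) -> forall j, submod P (tens j (M (Dlow m' m) u)).
Proof.
move=> mm' Pu j; have := submod_act (dressedF mm') (Pu j); rewrite step_tens.
rewrite act_scalel tensZ scalerA => Pj.
have {Pj} := submodB Pj (submodZ _ (submod_Kq m' (Pu m'))).
move=> /(_ ((j == m)%:R * z)); rewrite addrK => /(submodZ (q ^- (j == m))).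
by rewrite scalerA mulVf ?scale1r // !expf_neq0.
Qed.

Lemma submod_G P (m m' : 'I_n) u : m' = m.+1 :> nat ->
    (forall j, submod P (tens j u)) -> forall j, submod P (tens j (M (Gup m m') u)).
Proof.
move=> mm' Pu j; have := submod_act (dressedG mm') (Pu j); rewrite step_tens.
rewrite act_scalel tensZ scalerA => Pj.
have {Pj} := submodB Pj (submodZ _ (submod_Kq m' (Pu m))).
move=> /(_ ((j == m')%:R * z)); rewrite addrK => /(submodZ (q ^- (j == m))).
by rewrite scalerA mulVf ?scale1r // !expf_neq0.
Qed.

(** The vectors u with every e_j (x) u in a given submodule are thus stable under U_q(n) acting on V
    alone, which is what lets irreducibility of V be applied. *)
Lemma submod_uq P u x :
  (forall j, submod P (tens j u)) -> forall j, submod P (tens j (M x u)).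
Proof.
have zs0 : z * s^-1 != 0 by rewrite mulf_neq0 ?invr_neq0.
(* Recovers e_i and f_i from the entries of [Ehat] by dividing out the scalar and the Cartan
   prefactor. *)
have divkk y a b : y = (z * s^-1)^-1 *: (kV a * (kV b * ((z * s^-1) *: (k b * k a * y)))).
  rewrite -!scalerAr scalerA mulVf // scale1r -!mulrA (mulrA (kV b)) uq_kVK mul1r.
  by rewrite mulrA uq_kVK mul1r.
have [t ->] := uqpi_surj x; elim: t u => [c|[i|i|i|i]|t IHt t' IHt'|t IHt t' IHt'] u Pu j.
- by rewrite uq_cstE act_scalel uq_act1 tensZ; apply: submodZ.
- rewrite -/(uq_e s i) (divkk (uq_e s i) (simple_hi i) (simple_lo i)).
  rewrite -(Gup_simple s0 z0 q2).
  rewrite act_scalel tensZ !uq_actM; apply/submodZ/submod_phikV/submod_phikV.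
  exact: submod_G.
- rewrite -/(uq_f s i) (divkk (uq_f s i) (simple_lo i) (simple_hi i)).
  rewrite -(Dlow_simple s0 z0 q2).
  rewrite act_scalel tensZ !uq_actM; apply/submodZ/submod_phikV/submod_phikV.
  exact: submod_F.
- exact: submod_phik.
- exact: submod_phikV.
- rewrite uqpiDE act_addl -[M _ u]scale1r tens_linear.
  by apply: submod_lin; [apply: IHt|apply: IHt'].
- by rewrite uqpiME uq_actM; apply: IHt => l; apply: IHt'.
Qed.

(** Induction on j for all u. For j' = j + 1 and u0 = K_j^-1 u, the opposite coproduct of F sends
    e_j (x) u0 to e_j (x) F u0 + z e_j' (x) u; [DT_phiF] then expresses D^T on e_j' (x) u through
    D^T on e_j (x) u0 and e_j (x) F u0. *)
Lemma submod_DT P (j : 'I_n) u : (forall i : 'I_n, (i < j)%N -> submod P (tens i u)) ->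
  submod P (mact DT (tens j u) - q ^- (2 * j) *: tens j (M (Kq j) u)).
Proof.
move Ej : (j : nat) => N; elim: N j u Ej => [|N IHN] j' u Ej Pu.
  rewrite muln0 expr0 invr1 scale1r.
  have -> : mact DT (tens j' u) = tens j' (M (Kq j') u).
    apply/ffunP => i; rewrite mact_tens mxE ffunE.
    case: eqP => [->|/eqP ij]; first by rewrite Dlow_diag.
    by rewrite Dlow_gt ?act_0l //; move: ij; rewrite -val_eqE /=; lia.
  by rewrite subrr; apply: submod0.
have lt_N : (N < n)%N by have := ltn_ord j'; lia.
pose j := Ordinal lt_N; have jj' : j' = j.+1 :> nat by [].
have jNj' : (j == j') = false by rewrite -val_eqE /=; lia.
pose u0 := M (KqV j) u; have uE : M (Kq j) u0 = u.
  by rewrite -uq_actM KqKV uq_act1.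
pose Ff := Dlow j' j.
have Pu0 (i : 'I_n) : (i < j')%N -> submod P (tens i u0).
  by rewrite Ej => lt_i; apply/submod_KqV/Pu.
(* For i < j the coproduct of F has no cross term on e_i, so the induction hypothesis also covers F
   u0. *)
have PF (i : 'I_n) : (i < j)%N -> submod P (tens i (M Ff u0)).
  move=> lt_i; have lt_i' : (i < j')%N by rewrite jj' ltnW.
  have := submod_act (dressedF jj') (Pu0 _ lt_i'); rewrite step_tens.
  by rewrite -val_eqE (ltn_eqF lt_i) /= scale0r addr0 expr0 scale1r.
have PA := IHN j u0 erefl.
have {}PA := PA (fun i lt_i => Pu0 i (leq_trans (leqW lt_i) (eq_leq (esym Ej)))).
have PB := IHN j (M Ff u0) erefl PF.
(* Trades q e_j (x) F u for - z e_j' (x) K_j' u modulo the submodule: one of the two factors q^-1 of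
   the step. *)
have PC := submod_act (dressedF jj') (Pu j (ltnSn _)).
clearbody u0.
have shift : mact (phiF j j') (mact DT (tens j u0)) =
    mact DT (tens j (M Ff u0)) + z *: mact DT (tens j' u).
  rewrite -mactM -DT_phiF // mactM step_tens jNj' eqxx expr0 !scale1r.
  by rewrite act_scalel uE tensZ mactD mactZ.
(* The other factor q^-1, from moving K_j past F. *)
have KF : M (Kq j) (M Ff u0) = q^-1 *: M Ff u.
  have jj : (j <= j')%N by rewrite jj'.
  have := Kq_Dlow s0 z0 q2 j jj; rewrite eqxx jNj' expr0 expr1 scale1r => KD.
  rewrite -[in RHS]uE -!uq_actM -act_scalel -KD scalerA mulVf ?scale1r //.
  by rewrite expf_neq0.
rewrite KF in PB; rewrite step_tens eqxx expr1 scale1r act_scalel in PC.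
rewrite uE in PA.
set w := mact DT (tens j' u) in shift *.
set x := tens j' (M (Kq j') u) in PC *.
suff : submod P (z *: (w - q ^- (2 * N.+1) *: x)).
  by move/(submodZ z^-1); rewrite scalerA mulVf // scale1r.
have -> : z *: (w - q ^- (2 * N.+1) *: x) =
   mact (phiF j j') (mact DT (tens j u0)) -
   (mact DT (tens j (M Ff u0)) - q ^- (2 * N) *: tens j (q^-1 *: M Ff u)) -
   q ^- (2 * N.+1) *: (q *: tens j (M Ff u) + tens j' (z *: M (Kq j') u)).
  rewrite shift tensZ tensZ -/x mulnS exprD.
  set y := tens j _; set y' := mact _ _.
  have qN0 : q ^+ (2 * N) != 0 by rewrite !expf_neq0.
  move: (q ^+ (2 * N)) qN0 => Q Q0.
  by lin F; field; rewrite ?s0 ?Q0.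
apply: submodB; last exact: submodZ.
apply: submodB => //.
apply: submod_act; first exact: dressedF.
rewrite -(subrK (q ^- (2 * N) *: tens j u) (mact DT _)).
by apply: submodD => //; apply/submodZ/Pu.
Qed.


(** * The flag generated by the highest weight vector *)

Section HighestWeight.

Variables (L : 'I_n -> int) (v0 : V).
Hypotheses (e_v0 : forall i, M (uq_e s i) v0 = 0).
Hypotheses (k_v0 : forall i, M (k i) v0 = s ^ L i *: v0).

Definition flag (m : nat) : vec -> Prop :=
  submod (fun w => exists2 j : 'I_n, (j < m)%N & w = tens j v0).

Lemma flag_tens m (j : 'I_n) : (j < m)%N -> flag m (tens j v0).
Proof. by move=> jm; apply: submod_base; exists j. Qed.

Lemma flag_mono m m' w : (m <= m')%N -> flag m w -> flag m' w.
Proof.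
move=> mm'; apply: submod_mono => {}w [j jm ->].
by exists j => //; apply: leq_trans mm'.
Qed.

Lemma Kq_v0 i : M (Kq i) v0 = q ^ L i *: v0.
Proof.
rewrite uq_actM k_v0 actZ k_v0 scalerA -expfzDr // exprnP exprz_exp.
by congr (s ^ _ *: _); lia.
Qed.

Lemma Eup_v0 a d : M (uq_Eup s n a d) v0 = 0.
Proof.
have ev m : M (nat_e s n m) v0 = 0.
  by rewrite /nat_e; case: insubP => [i _ _|_]; rewrite ?act_0l.
elim: d => [|d IHd] //=.
by rewrite /qcomm -scaleNr act_addl act_scalel !uq_actM ev IHd !act0 scaler0 addr0.
Qed.

(** The off-diagonal entries are zero or multiples of raising root vectors, which kill v0; only K_j
    survives. *)
Lemma UT_v0 j : mact UT (tens j v0) = q ^ L j *: tens j v0.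
Proof.
apply/ffunP => i; rewrite mact_tens mxE !ffunE /Uup.
case: (ltngtP j i) => [lt_ji|gt_ji|/val_inj <-].
- rewrite (EhatE s) -?val_eqE /=; last by lia.
  rewrite /Ekk act_scalel uq_actM /uq_E lt_ji Eup_v0 act0 scaler0.
  by case: eqP lt_ji => [->|_ _]; rewrite ?ltnn ?scaler0.
- by rewrite act_0l; case: eqP gt_ji => [->|_ _]; rewrite ?ltnn ?scaler0.
- by rewrite eqxx -Kq_v0 /uq_Ehat eqxx expr2.
Qed.

Definition eigval (j : 'I_n) : F := q ^ (2 * (L j - j%:Z)).

Lemma Ymx_tens (j : 'I_n) : flag j (mact Ymx (tens j v0) - eigval j *: tens j v0).
Proof.
rewrite mactM UT_v0 mactZ.
have -> : eigval j = q ^ L j * (q ^- (2 * j) * q ^ L j).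
  have q0 : q != 0 by rewrite expf_neq0.
  rewrite /eigval [q ^- _]exprnN -!expfzDr //; congr (q ^ _); lia.
rewrite -scalerA -scalerBr; apply: submodZ.
rewrite -scalerA -tensZ -Kq_v0; apply: submod_DT => i; exact: flag_tens.
Qed.

(** Only the generator e_m (x) v0 needs the eigenvalue of index m: for j < m, both e_j (x) v0 and
    its image under Y already lie in [flag m]. *)
Lemma Ymx_flag (m : 'I_n) w : flag m.+1 w -> flag m (mact Ymx w - eigval m *: w).
Proof.
apply: submod_commuting; first exact: Ymx_dressed.
move=> _ [j jm ->]; have [<-|ne] := eqVneq j m; first exact: Ymx_tens.
have lt_jm : (j < m)%N by move: ne; rewrite -val_eqE /=; lia.
rewrite -(subrK (eigval j *: tens j v0) (mact _ _)) -addrA.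
apply: submodD; first exact: flag_mono (ltnW lt_jm) (Ymx_tens j).
by apply: submodB; apply/submodZ/flag_tens.
Qed.

Lemma flag_full : v0 != 0 -> irreducible_module M -> forall w, flag n w.
Proof.
move=> v0n0 [_ irr] w.
pose P u := forall j, flag n (tens j u).
have P0 : P 0 by move=> j; rewrite tens0; apply: submod0.
have PL c u v : P u -> P v -> P (c *: u + v).
  by move=> Pu Pv j; rewrite tens_linear; exact: submod_lin (Pu j) (Pv j).
have [W WP] := vspace_of_pred P0 PL.
have stab x v : v \in W -> M x v \in W.
  by move=> /WP Pv; apply/WP; exact: (submod_uq x Pv).
have [W0|WT] := irr W stab.
  have : v0 \in W by apply/WP => j; apply: flag_tens.
  by rewrite W0 memv0 (negPf v0n0).
rewrite [w]tens_sum; apply: submod_sum => i.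
have /WP Pw : w i \in W by rewrite WT memvf.
exact: Pw.
Qed.

Lemma mact_scalar c w : mact (c%:A%:M) w = c *: w.
Proof.
apply/ffunP => i; rewrite !ffunE (bigD1 i) //= mxE eqxx mulr1n act_scalel uq_act1.
rewrite big1 ?addr0 // => j; rewrite eq_sym mxE => /negPf ->.
by rewrite mulr0n act_0l.
Qed.

Lemma mact_sub N P w : mact (N - P) w = mact N w - mact P w.
Proof.
apply/ffunP => i; rewrite !ffunE -sumrB; apply: eq_bigr => j _.
by rewrite !mxE act_addl -scaleN1r act_scalel scaleN1r.
Qed.

Lemma mact_A w : mact (uq_A s n) w = z^-1 *: (w - mact Xmx w).
Proof.
rewrite uq_AE; apply/ffunP => i; rewrite !ffunE.
under eq_bigr do rewrite mxE act_scalel -scaleN1r act_addl act_scalel scaleN1r.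
rewrite -scaler_sumr sumrB; congr (_ *: (_ - _)).
rewrite (bigD1 i) //= eqxx uq_act1 big1 ?addr0 // => j.
by rewrite eq_sym => /negPf ->; apply: act_0l.
Qed.

Definition char_root (j : 'I_n) : F := (1 - (eigval j)^-1) / z.

Lemma char_factor j w :
  mact (uq_A s n - (char_root j)%:A%:M) w = - z^-1 *: (mact Xmx w - (eigval j)^-1 *: w).
Proof.
rewrite mact_sub mact_scalar mact_A /char_root; move: (eigval j)^-1 => d.
by move: z z0 => t t0; lin F; field.
Qed.

(** Every factor acts as an affine function of X. *)
Lemma char_Xmx (m : nat) (r : nat -> F) w :
  mact (\prod_(0 <= j < m) (uq_A s n - (r j)%:A%:M)) (mact Xmx w) =
  mact Xmx (mact (\prod_(0 <= j < m) (uq_A s n - (r j)%:A%:M)) w).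
Proof.
elim: m w => [|m IHm] w; first by rewrite big_geq // !mact1.
rewrite big_nat_recr //= !(mactM _ (uq_A s n - _)) -IHm; congr (mact _ _).
by rewrite !mact_sub !mact_scalar !mact_A mactB mactZ mactB mactZ.
Qed.

(** The factor of largest index acts first. Since X Y = 1, X - c^-1 = - c^-1 X (Y - c), so it maps w
    to a multiple of X applied to a vector of [flag m]. Moving X to the left of the remaining
    factors avoids any claim that X preserves the flag. *)
Lemma char_flag (r : nat -> F) m w : (m <= n)%N ->
    (forall j : 'I_n, r j = char_root j) -> flag m w ->
  mact (\prod_(0 <= j < m) (uq_A s n - (r j)%:A%:M)) w = 0.
Proof.
move=> le_mn rE; elim: m le_mn w => [|m IHm] lt_mn w Fw.
  rewrite big_geq // mact1; elim: Fw => {w} [w [j]|||] //.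
    by move=> c u v _ -> _ ->; rewrite scaler0 addr0.
  by move=> N u _ _ ->; rewrite mact0.
pose j := Ordinal lt_mn; have Ej0 : eigval j != 0 by rewrite expfz_neq0 // expf_neq0.
have /(IHm (ltnW lt_mn)) Yw := Ymx_flag (m := j) Fw.
rewrite big_nat_recr //= mactM -[m]/(val j) rE char_factor mactZ.
have -> : mact Xmx w - (eigval j)^-1 *: w =
    - (eigval j)^-1 *: mact Xmx (mact Ymx w - eigval j *: w).
  rewrite mactB mactZ -mactM Xmx_Ymx mact1 scalerBr scalerA mulNr mulVf //.
  by rewrite !scaleNr scale1r opprK addrC.
by rewrite mactZ char_Xmx Yw mact0 !scaler0.
Qed.

Lemma characteristic_identity : v0 != 0 -> irreducible_module M ->
  forall i j v, M ((\prod_(r < n) (uq_A s n - (char_root r)%:A%:M)) i j) v = 0.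
Proof.
move=> v0n0 irr i j v.
(* The roots are extended by 0 to all naturals, so that the product can be peeled from its end. *)
pose r (m : nat) := if insub m is Some l then char_root l else 0.
have rE (l : 'I_n) : r l = char_root l by rewrite /r valK.
have -> : \prod_(l < n) (uq_A s n - (char_root l)%:A%:M) =
          \prod_(0 <= l < n) (uq_A s n - (r l)%:A%:M).
  by rewrite big_mkord; apply: eq_bigr => l _; rewrite rE.
by rewrite -mact_tens (char_flag (leqnn n) rE) ?ffunE //; apply: flag_full.
Qed.

End HighestWeight.
End Dressed.

(** * The identity for real q > 0, q <> 1 *)

Local Open Scope complex_scope.

Theorem mainTheorem1 (R : realType) (q : R) (n : nat) (L : 'I_n -> int)
    (V : vectType R[i]) (M : uq_module (Num.sqrt q)%:C n V)
    (q_gt0 : 0 < q) (q_neq1 : q != 1) (n_ge2 : (2 <= n)%N)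
    (L_dominant : forall i j : 'I_n, (i <= j)%N -> L j <= L i)
    (M_irreducible : irreducible_module M)
    (M_highest_weight : has_highest_weight M L) :
  let alpha (r : 'I_n) : int := L r - r%:Z in
  let a (r : 'I_n) : R := (1 - q ^ (- 2 * alpha r)) / (q - q^-1) in
  forall (i j : 'I_n) (v : V),
    M ((\prod_(r < n) (uq_A (Num.sqrt q)%:C n - ((a r)%:C)%:A%:M)) i j) v = 0.
Proof.
move=> alpha a i j v; set s := (Num.sqrt q)%:C in M M_irreducible M_highest_weight *.
have [v0 [v0_neq0 e_v0 k_v0]] := M_highest_weight.
have s2 : s ^+ 2 = q%:C by rewrite -rmorphXn /= sqr_sqrtr // ltW.
have q0 : q != 0 by rewrite gt_eqF.
have real_neq0 (x : R) : x != 0 -> x%:C != 0 by rewrite fmorph_eq0.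
have s0 : s != 0 by rewrite real_neq0 // sqrtr_eq0 -ltNge.
have z0 : q - q^-1 != 0.
  rewrite subr_eq0; apply: contra q_neq1 => /eqP qV.
  rewrite -(@pexpr_eq1 _ q 2) ?ltW // expr2 {2}qV mulfV //.
have zC0 : s ^+ 2 - (s ^+ 2)^-1 != 0.
  by rewrite s2 -fmorphV -rmorphB; apply: real_neq0.
have q2 : (s ^+ 2) ^+ 2 + 1 != 0.
  rewrite s2 -rmorphXn -(rmorph1 (real_complex R)) -rmorphD; apply: real_neq0.
  by rewrite gt_eqF // ltr_pwDr // exprn_ge0 // ltW.
(* With indices from 0, L r - r is the shifted weight alpha of index r + 1. *)
have aE r : (a r)%:C = char_root s L r.
  rewrite /char_root /eigval s2 /a rmorphM fmorphV !rmorphB rmorph1 fmorphXz.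
  rewrite fmorphV; congr ((1 - _) / _).
  by rewrite invr_expz mulNr.
under eq_bigr do rewrite aE.
exact: (characteristic_identity s0 zC0 q2 e_v0 k_v0 v0_neq0 M_irreducible).
Qed.
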